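(* For any Poisson manifold $(M,w)$, the operator $d_h=d-h\delta$ satisfies $d_h^2=0$ and $$d_h(\alpha\wedge_h\beta)=(d_h\alpha)\wedge_h\beta+(-1)^{|\alpha|}\alpha\wedge_h(d_h\beta)$$ for $\alpha,\beta$ both in $\Omega(M)[h]$ or both in $\Omega(M)[h,h^{-1}]$ ($\alpha$ homogeneous).
   Context: $w$ is the Poisson bivector field of $M$. $\{e_i\}$ is a local frame of $TM$ with dual frame $\{e^i\}$, $w^{ij}=w(e^i,e^j)$ (antisymmetric), repeated indices are summed. Forms of degree $p$ have degree $p$, and $h$ is an indeterminate of degree $2$; $|\alpha|$ is the degree. For a vector $v$ and a form $\alpha$, $v\vdash\alpha$ is contraction of $v$ into the first slot and $\alpha\dashv v$ contraction of $v$ into the last slot. The quantum exterior product is $$\alpha\wedge_h\beta=\sum_{n\ge0}\frac{h^n}{n!}w^{i_1j_1}\cdots w^{i_nj_n}(\alpha\dashv e_{i_1}\dashv\cdots\dashv e_{i_n})\wedge(e_{j_n}\vdash\cdots\vdash e_{j_1}\vdash\beta)$$ (contractions on $\alpha$ by $e_{i_1}$ first, on $\beta$ by $e_{j_1}$ first), extended bilinearly over $\mathbb{R}[h]$, resp. $\mathbb{R}[h,h^{-1}]$. The Koszul codifferential $\delta:\Omega^k(M)\to\Omega^{k-1}(M)$ is $\delta\alpha=w\vdash(d\alpha)-d(w\vdash\alpha)$, where $w\vdash\beta=\frac12w^{kl}\,e_k\vdash(e_l\vdash\beta)$; $d$ and $\delta$ are extended linearly over $\mathbb{R}[h]$, resp.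 $\mathbb{R}[h,h^{-1}]$. *)

(* Defs.v *)
From HB Require Import structures.
From mathcomp Require Import all_boot all_order all_algebra.
From mathcomp Require Import all_classical all_reals all_analysis.

Set Implicit Arguments.
Unset Strict Implicit.
Unset Printing Implicit Defensive.

Import Order.TTheory GRing.Theory Num.Theory.
Import numFieldNormedType.Exports.

Local Open Scope classical_set_scope.
Local Open Scope ring_scope.

(* C^oo on U: all iterated directional derivatives exist at the points of U and
   are (Frechet) differentiable, hence continuous, there. *)
Definition smooth_on (R : realType) (V W : normedModType R)
    (U : set V) (f : V -> W) : Prop :=
  forall (vs : seq V) (x : V), U x ->
    differentiable (foldr (fun v g => 'D_v g) f vs) x.

(* Second countable Hausdorff smooth n-manifold, given by an indexed atlas.
   [chart_inv c] is the inverse of the chart [chart_map c]; the values of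
   [chart_map c] outside of [chart_dom c] and of [chart_inv c] outside of
   [chart_map c @` chart_dom c] are irrelevant. *)
Record manifold (R : realType) (n : nat) := Manifold {
  carrier :> topologicalType;
  carrier_hausdorff : hausdorff_space carrier;
  carrier_second_countable : @second_countable carrier;
  chart : Type;
  chart_dom : chart -> set carrier;
  chart_map : chart -> carrier -> 'rV[R]_n;
  chart_inv : chart -> 'rV[R]_n -> carrier;
  chart_dom_open : forall c, open (chart_dom c);
  chart_cover : \bigcup_c chart_dom c = setT;
  chart_image_open : forall c, open (chart_map c @` chart_dom c);
  chart_mapK : forall c p, chart_dom c p -> chart_inv c (chart_map c p) = p;
  chart_map_continuous :
    forall c, {within chart_dom c, continuous (chart_map c)};
  chart_inv_continuous :
    forall c, {within chart_map c @` chart_dom c, continuous (chart_inv c)};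
  chart_compat : forall c c',
    smooth_on (chart_map c @` (chart_dom c `&` chart_dom c'))
              (chart_map c' \o chart_inv c)
}.

Definition chart_image (R : realType) (n : nat) (M : manifold R n)
    (c : chart M) : set 'rV[R]_n :=
  chart_map c @` chart_dom c.

Definition overlap (R : realType) (n : nat) (M : manifold R n)
    (c c' : chart M) : set 'rV[R]_n :=
  chart_map c @` (chart_dom c `&` chart_dom c').

Definition transition (R : realType) (n : nat) (M : manifold R n)
    (c c' : chart M) : 'rV[R]_n -> 'rV[R]_n :=
  chart_map c' \o chart_inv c.

Section ExteriorAlgebra.
Variables (R : realType) (V : lmodType R).

(* A possibly inhomogeneous exterior form on V is a function of a finite list
   of vectors; its component of degree k is its restriction to lists of size k,
   which must be multilinear and alternating. *)
Definition multiform := seq V -> R.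

Implicit Types (a b : multiform) (v : V) (s : seq V).

Definition multilinear a : Prop :=
  forall s1 s2 (r : R) u v,
    a (s1 ++ (r *: u + v) :: s2) = r * a (s1 ++ u :: s2) + a (s1 ++ v :: s2).

Definition alternating_form a : Prop :=
  forall s1 s2 s3 v, a (s1 ++ v :: s2 ++ v :: s3) = 0.

Definition contract_first a v : multiform := fun s => a (v :: s).

Definition contract_last a v : multiform := fun s => a (rcons s v).

(* The number of inversions of the shuffle moving the entries selected by m in
   front of the others. *)
Definition inversions k (m : k.-tuple bool) : nat :=
  (\sum_(i < k) \sum_(j < k | i < j) (~~ tnth m i && tnth m j))%N.

(* Normalized so that (e^1 /\ e^2)(e_1, e_2) = 1. *)
Definition ext_prod a b : multiform := fun s =>
  \sum_(m : (size s).-tuple bool)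
    (-1) ^+ inversions m * a (mask m s) * b (mask (map negb m) s).

End ExteriorAlgebra.

Section PoissonManifold.
Variables (R : realType) (n : nat) (M : manifold R n).
Local Notation V := 'rV[R]_n.

(* A form on M is the family of its local representatives, each on the image of
   a chart and extended by zero elsewhere, so that two forms on M are equal iff
   they are equal as families. *)
Definition form_family := chart M -> V -> multiform V.

(* [Omega alpha] : alpha belongs to the sum Omega(M) of all Omega^k(M);
   alternating forms vanish on lists of size > n, so no bound on the degree is
   needed. *)
Definition Omega (alpha : form_family) : Prop :=
  [/\ forall c x, chart_image c x ->
        multilinear (alpha c x) /\ alternating_form (alpha c x),
      forall c s, smooth_on (chart_image c) (fun x => alpha c x s : R^o),
      forall c c' x s, overlap c c' x ->
        alpha c x s =
        alpha c' (transition c c' x) (map ('d (transition c c') x) s)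
    & forall c x, ~ chart_image c x -> alpha c x = 0].

(* The constant vector fields of a chart commute, so no bracket terms occur. *)
Definition ext_d (alpha : form_family) : form_family := fun c x s =>
  if x \in chart_image c then
    \sum_(k < size s) (-1) ^+ k *
      'D_(nth 0 s k) (fun y => alpha c y (take k s ++ drop k.+1 s) : R^o) x
  else 0.

(* [w c x i j] = w(dx^i, dx^j) at the point of coordinates x in the chart c. *)
Definition bivector_family := chart M -> V -> 'M[R]_n.

Definition bivector_field (w : bivector_family) : Prop :=
  [/\ forall c x, chart_image c x -> (w c x)^T = - w c x,
      forall c, smooth_on (chart_image c) (w c)
    & forall c c' x, overlap c c' x ->
        let J := lin1_mx ('d (transition c c') x) in
        w c' (transition c c' x) = J^T *m w c x *m J].

(* Components of the Schouten-Nijenhuis bracket of two bivector fields: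
   [u, v]^ijk = sum over the cyclic permutations of (i, j, k) of
   u^li d_l v^jk + v^li d_l u^jk. *)
Definition schouten (u v : bivector_family) c x (i j k : 'I_n) : R :=
  let partial (f : V -> R^o) (l : 'I_n) := 'D_(delta_mx 0 l) f x in
  let term i j k := \sum_(l < n)
    (u c x l i * partial (fun y => v c y j k) l +
     v c x l i * partial (fun y => u c y j k) l) in
  term i j k + term j k i + term k i j.

Definition poisson_bivector (w : bivector_family) : Prop :=
  bivector_field w /\
  forall c x, chart_image c x -> forall i j k, schouten w w c x i j k = 0.

(* A local frame over the domain of each chart; the rows of [e c x] are the
   coordinates of its vectors in the chart c, and the columns of
   [invmx (e c x)] those of the dual frame. *)
Definition frame_family := chart M -> V -> 'M[R]_n.

Definition local_frame (e : frame_family) : Prop :=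
  forall c, smooth_on (chart_image c) (e c) /\
            forall x, chart_image c x -> e c x \in unitmx.

Variables (w : bivector_family) (e : frame_family).

(* w^ij = w(e^i, e^j) *)
Definition frame_comp c x : 'M[R]_n :=
  (invmx (e c x))^T *m w c x *m invmx (e c x).

Definition contract_w (beta : form_family) : form_family := fun c x =>
  2^-1 *: \sum_(k < n) \sum_(l < n) frame_comp c x k l *:
    (contract_first (contract_first (beta c x) (row l (e c x)))
       (row k (e c x)) : seq V -> R^o).

Definition koszul (alpha : form_family) : form_family :=
  contract_w (ext_d alpha) - ext_d (contract_w alpha).

(* The coefficient of h^m / m! in the quantum product of two forms. *)
Definition qterm (m : nat) (alpha beta : form_family) : form_family :=
  fun c x =>
  let e_ (I : m.-tuple 'I_n) := [seq row i (e c x) | i <- I] in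
  \sum_(I : m.-tuple 'I_n) \sum_(J : m.-tuple 'I_n)
    (\prod_(k < m) frame_comp c x (tnth I k) (tnth J k)) *:
    (ext_prod (foldl (@contract_last R V) (alpha c x) (e_ I))
           (foldl (@contract_first R V) (beta c x) (e_ J)) : seq V -> R^o).

(* A Laurent polynomial in h with coefficients in the forms on M is given by
   the function mapping m to its coefficient of h^m. *)
Definition hform := int -> form_family.

Definition Omega_laurent (alpha : hform) : Prop :=
  (forall m, Omega (alpha m)) /\ finite_set [set m | alpha m <> 0].

Definition Omega_poly (alpha : hform) : Prop :=
  Omega_laurent alpha /\ forall m, m < 0 -> alpha m = 0.

(* h has degree 2. *)
Definition homogeneous (k : int) (alpha : hform) : Prop :=
  forall m c x s, alpha m c x s <> 0 -> (size s)%:Z + m * 2 = k.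

Definition d_h (alpha : hform) : hform :=
  fun m => ext_d (alpha m) - koszul (alpha (m - 1)).

Definition qwedge (alpha beta : hform) : hform := fun k =>
  \sum_(a \in [set: int]) \sum_(b \in [set: int])
    \sum_(m \in [set m : nat | a + b + m%:Z = k])
      (fun c x s => (m`!%:R)^-1 * qterm m (alpha a) (beta b) c x s).

Definition signed (k : int) (alpha : hform) : hform :=
  fun m c x s => (-1) ^ k * alpha m c x s.

End PoissonManifold.

(* Main.v *)
Require Import Defs.
From HB Require Import structures.
From mathcomp Require Import all_boot all_order all_algebra.
From mathcomp Require Import all_classical all_reals all_analysis.
From mathcomp Require Import ring lra zify finmap.

Set Implicit Arguments.
Unset Strict Implicit.
Unset Printing Implicit Defensive.

Import Order.TTheory GRing.Theory Num.Theory.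
Import numFieldNormedType.Exports.

Local Open Scope classical_set_scope.
Local Open Scope ring_scope.

(** Both identities are equalities of forms at a point of the image of a chart.
There the given frame can be traded for the coordinate frame, because the
contractions of multilinear forms with w do not depend on the frame
([frame_sum]). With i_k the contraction with the k-th coordinate vector field,

      d = sum_a dx^a /\ d_a ,      w |- = 1/2 sum_kl w^kl i_k i_l ,
      delta = [w |-, d] = - sum_a (sum_k w^ak i_k d_a + dx^a /\ ((d_a w) |-)) .

_The Leibniz rule._ One has alpha /\_h beta = mu (exp (h P) (alpha # beta)), where
# is the tensor product, mu the exterior product and P the pairing
sum_kl w^kl (- -| e_k) # (e_l |- -). Let the operators on the right factor
absorb the sign (-1)^|alpha|. Then contractions on the left and on the right
anticommute, contracting after mu is mu after the sum of the left and the right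
contraction, and multiplying by dx^a after mu is mu after multiplying by dx^a on
either side. The pairing P commutes with all contractions, and its commutator
with the left (right) multiplication by dx^a is a right (left) contraction; so
the commutator with P^m is m times that contraction times P^(m-1) ([power_x],
[power_y]). In the coefficient of h^m of the Leibniz rule this cancels all terms
that contain a derivative of alpha or of beta against the first-order part of
delta. The terms with a derivative of w reduce to a cubic expression in the
contractions, with coefficients sum_a w^ja d_a w^kl, which vanishes by the Jacobi
identity ([poisson_pairing]). The argument only uses the commutation rules of
the operators, so it is carried out in [deformed_leibniz] for abstract linear
maps; [leibniz_order] specializes it to forms at a point, and [laurent_leibniz]
sums over the powers of h.

_The square._ The symmetry of second derivatives ([derive_comm]) gives d^2 = 0,
and the Jacobi identity makes w |- commute with delta ([contr_bivector_koszul]).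
Since delta = [w |-, d], these two facts imply d delta + delta d = 0 and
2 delta^2 = 0 by algebra alone ([deformed_differential_sqr]). *)

(** * Linear algebra of bivector contractions *)

Lemma linear_comb2 (R : pzRingType) (E F : lmodType R) (A : {linear E -> F}) n
    (W : 'I_n -> 'I_n -> R) (z : 'I_n -> 'I_n -> E) :
  A (\sum_i \sum_j W i j *: z i j) = \sum_i \sum_j W i j *: A (z i j).
Proof.
rewrite linear_sum; apply: eq_bigr => i _.
by rewrite linear_sum; apply: eq_bigr => j _; rewrite linearZZ.
Qed.

Lemma eq_sum2 (R : pzRingType) (E : lmodType R) n (W : 'I_n -> 'I_n -> R)
  (z z' : 'I_n -> 'I_n -> E) :
  (forall i j, z i j = z' i j) ->
  \sum_i \sum_j W i j *: z i j = \sum_i \sum_j W i j *: z' i j.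
Proof. by move=> h; apply: eq_bigr => i _; apply: eq_bigr => j _; rewrite h. Qed.

Lemma scale_half_double (R : numFieldType) (E : lmodType R) (z : E) : z = 2^-1 *: (z + z).
Proof. by rewrite -mulr2n -[z *+ 2]scaler_nat scalerA mulVf ?pnatr_eq0 ?scale1r. Qed.

Section CyclicSum.
Variables (R : realFieldType) (E : lmodType R) (n : nat).

(** The Jacobi identity enters here. Adding to the sum its copy with the
indices a and b exchanged, and using that z is antisymmetric in them, replaces
the coefficient by t a b c - t b a c = t a b c + t b c a = - t c a b. *)
Lemma cyclic_sum (t : 'I_n -> 'I_n -> 'I_n -> R) (z : 'I_n -> 'I_n -> 'I_n -> E) :
  (forall a b c, t a b c = - t a c b) ->
  (forall a b c, t a b c + t b c a + t c a b = 0) ->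
  (forall a b c, z a b c = - z b a c) ->
  \sum_a \sum_b \sum_c t a b c *: z a b c =
  - (2^-1 *: \sum_a \sum_b \sum_c t c a b *: z a b c).
Proof.
move=> ta tc za.
rewrite [LHS]scale_half_double -scalerN; congr (_ *: _).
rewrite {2}exchange_big -big_split -sumrN /=; apply: eq_bigr => a _.
rewrite -big_split -sumrN /=; apply: eq_bigr => b _.
rewrite -big_split -sumrN /=; apply: eq_bigr => c _.
rewrite (za b a) scalerN -scaleNr -scalerDl -scaleNr; congr (_ *: _).
rewrite (ta b a c); have := tc a b c; lra.
Qed.

(** By [cyclic_sum] and the invariance of z under cyclic permutations, the sum
S satisfies S = - S / 2. *)
Lemma totally_antisym_sum (t : 'I_n -> 'I_n -> 'I_n -> R) (z : 'I_n -> 'I_n -> 'I_n -> E) :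
  (forall a b c, t a b c = - t a c b) ->
  (forall a b c, t a b c + t b c a + t c a b = 0) ->
  (forall a b c, z a b c = - z b a c) -> (forall a b c, z a b c = - z a c b) ->
  \sum_a \sum_b \sum_c t a b c *: z a b c = 0.
Proof.
move=> ta tc za zb; set S := LHS.
have SE : S = - (2^-1 *: S).
  rewrite {1}/S (cyclic_sum ta tc za); congr (- (_ *: _)).
  under eq_bigr do rewrite exchange_big /=.
  rewrite exchange_big /=; apply: eq_bigr => a _; apply: eq_bigr => b _.
  by apply: eq_bigr => c _; rewrite zb za opprK.
have : (1 + 2^-1) *: S = 0 by rewrite scalerDl scale1r {1}SE addNr.
move/eqP; rewrite scaler_eq0 => /orP[|/eqP//].
by rewrite gt_eqF// addr_gt0// ?ltr01 ?invr_gt0 ?ltr0n.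
Qed.

End CyclicSum.

Lemma sum_delta (R : pzRingType) n (E1 : lmodType R) (a : 'I_n) (z : 'I_n -> E1) : \sum_k
  (k == a)%:R *: z k = z a.
Proof.
rewrite (bigD1 a) //= eqxx scale1r big1 ?addr0// => k /negbTE ->.
by rewrite scale0r.
Qed.

Section LinearCombinations.
Variables (R : comPzRingType) (n : nat) (E1 E2 : lmodType R).
Implicit Types (W : 'M[R]_n) (a : 'I_n).

Fact sum2_linear W (A : 'I_n -> 'I_n -> {linear E1 -> E2}) :
  linear (fun s => \sum_k \sum_l W k l *: A k l s).
Proof.
move=> r s s'; rewrite scaler_sumr -big_split; apply: eq_bigr => k _.
rewrite scaler_sumr -big_split; apply: eq_bigr => l _ /=.
by rewrite linearP scalerDr !scalerA mulrC.
Qed.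

Fact sum1_linear W a (A : 'I_n -> {linear E1 -> E2}) :
  linear (fun s => \sum_k W a k *: A k s).
Proof.
move=> r s s'; rewrite scaler_sumr -big_split; apply: eq_bigr => k _.
by rewrite linearP scalerDr !scalerA mulrC.
Qed.

End LinearCombinations.

Section Jacobiator.
Variables (R : realFieldType) (n : nat) (W : 'M[R]_n) (dW : 'I_n -> 'M[R]_n).

(** If W is a bivector and dW a its derivative in the direction a, the cyclic
sum of this tensor is, up to a factor, the Schouten bracket of W with itself. *)
Definition jacobiator (j k l : 'I_n) := \sum_a W j a * dW a k l.

Lemma jacobiator_anti j k l : (forall a, (dW a)^T = - dW a) ->
  jacobiator j k l = - jacobiator j l k.
Proof.
move=> dW_anti; rewrite /jacobiator -sumrN; apply: eq_bigr => a _; rewrite -mulrN; congr (_ * _).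
by have /matrixP/(_ l k) := dW_anti a; rewrite !mxE.
Qed.

Lemma sum_jacobiator (E1 : lmodType R) (h : 'I_n -> 'I_n -> 'I_n -> E1) : W^T = - W ->
  \sum_a \sum_j W a j *: (\sum_k \sum_l dW a k l *: h j k l) =
  - \sum_j \sum_k \sum_l jacobiator j k l *: h j k l.
Proof.
move=> W_anti; rewrite exchange_big -sumrN; apply: eq_bigr => j _.
under eq_bigr => a _.
  rewrite scaler_sumr; under eq_bigr => k _.
    rewrite scaler_sumr; under eq_bigr do rewrite scalerA; over.
  over.
rewrite exchange_big -sumrN; apply: eq_bigr => k _.
rewrite exchange_big -sumrN; apply: eq_bigr => l _ /=.
rewrite -scaler_suml -scaleNr; congr (_ *: _); rewrite /jacobiator -sumrN.
apply: eq_bigr => a _; have /matrixP/(_ j a) := W_anti; rewrite !mxE => ->.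
by rewrite mulNr.
Qed.

End Jacobiator.

(** Model: u k is contraction with the k-th basis vector, e a multiplication
by the dual covector, and ok holds for the alternating elements, on which
contractions anticommute. Then [contr_row W a] is contraction with the vector
W(dx^a, -), and [contr_bivector W] is the operator w |-. *)
Section Contractions.
Variables (R : realFieldType) (n : nat) (E : lmodType R) (u : 'I_n -> {linear E -> E}).
Implicit Types (W : 'M[R]_n) (a : 'I_n) (z : E).

Definition contr_row W a z : E := \sum_k W a k *: u k z.
Definition contr_bivector W z : E := 2^-1 *: \sum_k \sum_l W k l *: u k (u l z).

Fact contr_row_linear W a : linear (contr_row W a).
Proof. exact: (sum1_linear W a u). Qed.
HB.instance Definition _ W a := GRing.isLinear.Build R E E _ (contr_row W a)
  (contr_row_linear W a).

Fact contr_bivector_linear W : linear (contr_bivector W).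
Proof.
by move=> r z z'; rewrite /contr_bivector (sum2_linear W (fun k l => u k \o u l)) linearP.
Qed.
HB.instance Definition _ W := GRing.isLinear.Build R E E _ (contr_bivector W)
  (contr_bivector_linear W).

Variables (e : 'I_n -> {linear E -> E}) (ok : E -> Prop).
Hypothesis ok_u : forall k z, ok z -> ok (u k z).
Hypothesis uu : forall k l z, ok z -> u k (u l z) = - u l (u k z).
Hypothesis ue : forall k a z, u k (e a z) = (k == a)%:R *: z - e a (u k z).

Lemma contr_bivector_u W k z : ok z -> contr_bivector W (u k z) = u k (contr_bivector W z).
Proof.
move=> zok; rewrite /contr_bivector linearZZ (linear_comb2 (u k)); congr (_ *: _).
apply: eq_sum2 => p q; rewrite (uu q k zok) linearN (uu p k) ?opprK //.
exact: ok_u.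
Qed.

Lemma contr_bivectorC W W' z : ok z -> contr_bivector W (contr_bivector W' z) =
  contr_bivector W' (contr_bivector W z).
Proof.
move=> zok; rewrite [contr_bivector W' z]/contr_bivector linearZZ
  (linear_comb2 (contr_bivector W)); congr (_ *: _).
by apply: eq_sum2 => k l /=; rewrite !contr_bivector_u//; exact: ok_u.
Qed.

Lemma contr_bivector_row W W' a z : ok z -> contr_bivector W (contr_row W' a z) =
  contr_row W' a (contr_bivector W z).
Proof.
move=> zok; rewrite /contr_row linear_sum; apply: eq_bigr => k _.
by rewrite linearZZ /= contr_bivector_u.
Qed.

(** Moving dx^a past two contractions u k, u l leaves a single contraction with
u k if l = a, and minus one with u l if k = a; the antisymmetry of W makes both
contributions equal. *)
Lemma contr_bivector_wedge W a z : W^T = - W -> contr_bivector W (e a z) =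
  e a (contr_bivector W z) - contr_row W a z.
Proof.
move=> Wanti; have Wa k l : W k l = - W l k.
  by have /matrixP/(_ l k) := Wanti; rewrite !mxE.
have E1 : \sum_k \sum_l W k l *: u k (u l (e a z)) =
    \sum_k \sum_l W k l *: e a (u k (u l z)) - (contr_row W a z + contr_row W a z).
  transitivity (\sum_k (\sum_l W k l *: e a (u k (u l z)) +
      (\sum_l (l == a)%:R *: (W k l *: u k z) - (k == a)%:R *: \sum_l W k l *: u l z))).
    apply: eq_bigr => k _; rewrite scaler_sumr -sumrB -big_split; apply: eq_bigr => l _ /=.
    rewrite ue (linearB (u k)) (linearZZ (u k)) /= ue opprB scalerDr scalerBr addrCA.
    by rewrite !scalerA [W k l * _]mulrC [W k l * _]mulrC.
  rewrite big_split sumrB /= sum_delta opprD; congr (_ + (_ - _)).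
  rewrite /contr_row -sumrN; apply: eq_bigr => k _.
  by rewrite sum_delta Wa scaleNr.
rewrite /contr_bivector E1 scalerBr (linearZZ (e a)) (linear_comb2 (e a)).
by rewrite -scale_half_double.
Qed.

(** The codifferential as an operator on first-order jets: if z is the value
of a form and dz a its derivative in the direction a, this is the commutator
of w |- with d = sum_a e a d_a, computed by [contr_bivector_wedge]. *)
Definition koszul_jet W (dW : 'I_n -> 'M[R]_n) z (dz : 'I_n -> E) : E :=
  - \sum_a (contr_row W a (dz a) + e a (contr_bivector (dW a) z)).

(** The operator w |- commutes with the codifferential: the two sides differ
by a multiple of a contraction with the jacobiator over three indices, and such
a contraction vanishes by [totally_antisym_sum]. *)
Lemma contr_bivector_koszul W dW z (dz : 'I_n -> E) :
  W^T = - W -> (forall a, (dW a)^T = - dW a) ->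
  (forall j k l, jacobiator W dW j k l + jacobiator W dW k l j + jacobiator W dW l j k = 0) ->
  ok z -> (forall a, ok (dz a)) ->
  contr_bivector W (koszul_jet W dW z dz) =
  koszul_jet W dW (contr_bivector W z)
    (fun a => contr_bivector W (dz a) + contr_bivector (dW a) z).
Proof.
move=> W_anti dW_anti jac zok dzok.
rewrite /koszul_jet linearN linear_sum; congr (- _); apply/eqP.
rewrite -subr_eq0 -sumrB; apply/eqP.
transitivity (- \sum_a (contr_row W a (contr_bivector (dW a) z) +
  contr_row W a (contr_bivector (dW a) z))).
  rewrite -sumrN; apply: eq_bigr => a _.
  rewrite (linearD (contr_bivector W)) (linearD (contr_row W a)) /=
    contr_bivector_row// contr_bivector_wedge// contr_bivectorC//.
  rewrite -addrA opprD opprD addrACA addrA.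
  rewrite [X in X + _]addrCA [X in (_ + X) + _]addrA subrr add0r.
  by rewrite [X in _ + X]addrC addrACA subrr add0r -opprD.
suff S0 : \sum_a contr_row W a (contr_bivector (dW a) z) = 0 by rewrite big_split /=
  S0 addr0 oppr0.
transitivity (2^-1 *: - \sum_j \sum_k \sum_l jacobiator W dW j k l *: u j (u k (u l z))).
  rewrite -sum_jacobiator// scaler_sumr; apply: eq_bigr => a _.
  rewrite scaler_sumr; apply: eq_bigr => j _.
  by rewrite /contr_bivector (linearZZ (u j)) (linear_comb2 (u j)) !scalerA mulrC.
rewrite (totally_antisym_sum (t := jacobiator W dW)) ?oppr0 ?scaler0// => a b c.
- exact: jacobiator_anti.
- by rewrite (uu a b)//; exact: ok_u.
- by rewrite (uu b c)// linearN.
Qed.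

End Contractions.

(** * An abstract deformed Leibniz rule *)

(** The cancellations in [deformed_leibniz] for one direction: p, q, cA, cB,
cA', cB' are the terms with a derivative of one of the factors, r, s and s'
those with a derivative of W multiplied by the covector. What is left on the
right is the defect that the Jacobi identity removes. *)
Lemma leibniz_terms (R : pzRingType) (F : lmodType R) (N M : R)
    (p q r cA cB cA' cB' k k' s s' h h' : F) :
  p + q + N *: r +
    N *: (cA + cB + M *: k + (cA' + cB' + M *: k') + (s + s' - r)) -
  (p + N *: cA' + (q + N *: cB) +
   N *: (cA + (s + M *: h') + (cB' + (s' + M *: h)))) =
  (N * M) *: (k + k' - (h' + h)).
Proof.
set D1 := cA + _ + _ + _ + _; set D2 := cA + _ + _.
have -> : p + q + N *: r + N *: D1 = p + q + N *: (r + D1) by rewrite -addrA -scalerDr.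
have -> : p + N *: cA' + (q + N *: cB) + N *: D2 = p + q + N *: (cA' + cB + D2).
  by rewrite [p + _ + _]addrACA -[LHS]addrA -!scalerDr.
rewrite opprD {}/D1 {}/D2 addrACA subrr add0r -scalerBr -scalerA; congr (_ *: _).
rewrite scalerBr !scalerDr; move: (_ *: k) (_ *: k') (_ *: h) (_ *: h') => K K' H H'.
rewrite addrCA [r + (_ - r)]addrC subrK.
rewrite [X in _ - X](_ : _ = H' + H + (cA + cB + cA' + cB' + s + s')); last first.
  by rewrite !addrA [LHS](ACl (5*8*3*2*1*6*4*7))/=.
rewrite [X in X - _](_ : _ = K + K' + (cA + cB + cA' + cB' + s + s')); last first.
  by rewrite !addrA [LHS](ACl (3*6*1*2*4*5*7*8))/=.
by rewrite opprD addrACA subrr addr0.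
Qed.

(** The space E models pairs of forms and F forms; u, x are the contractions
and covector multiplications on the left factor, g, y those on the right
factor, corrected by the sign of the left factor so that they anticommute with
the former. The map mu models the exterior product; i and e are contraction
and covector multiplication on F. *)
Section DeformedLeibniz.
Variables (R : realFieldType) (n : nat) (E F : lmodType R).
Variables (u g x y : 'I_n -> {linear E -> E}) (mu : {linear E -> F}).
Variables (i e : 'I_n -> {linear F -> F}) (ok : E -> Prop).

Hypothesis ok0 : ok 0.
Hypothesis okD : forall z z', ok z -> ok z' -> ok (z + z').
Hypothesis okZ : forall r z, ok z -> ok (r *: z).
Hypothesis ok_u : forall k z, ok z -> ok (u k z).
Hypothesis ok_g : forall k z, ok z -> ok (g k z).
Hypothesis uu : forall k l z, ok z -> u k (u l z) = - u l (u k z).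
Hypothesis gg : forall k l z, ok z -> g k (g l z) = - g l (g k z).
Hypothesis ug : forall k l z, u k (g l z) = - g l (u k z).
Hypothesis ux : forall k a z, u k (x a z) = (k == a)%:R *: z - x a (u k z).
Hypothesis gy : forall k a z, g k (y a z) = (k == a)%:R *: z - y a (g k z).
Hypothesis uy : forall k a z, u k (y a z) = - y a (u k z).
Hypothesis gx : forall k a z, g k (x a z) = - x a (g k z).
Hypothesis mu_i : forall k z, i k (mu z) = mu (u k z) + mu (g k z).
Hypothesis mu_x : forall a z, mu (x a z) = e a (mu z).
Hypothesis mu_y : forall a z, mu (y a z) = e a (mu z).

Implicit Types (W : 'M[R]_n) (z : E) (a k l : 'I_n).

Definition pairing W z : E := \sum_k \sum_l W k l *: g l (u k z).

Fact pairing_linear W : linear (pairing W).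
Proof. exact: (sum2_linear W (fun k l => g l \o u k)). Qed.
HB.instance Definition _ W := GRing.isLinear.Build R E E _ (pairing W) (pairing_linear W).

Definition power W m z : E := iter m (pairing W) z.

Arguments power W m z : simpl never.

Fact power_linear W m : linear (power W m).
Proof. by elim: m => // m IH r z z'; rewrite /power !iterS [X in pairing W X]IH linearP. Qed.
HB.instance Definition _ W m := GRing.isLinear.Build R E E _ (power W m) (power_linear W m).

Lemma ok_sum (r : seq 'I_n) (h : 'I_n -> E) : (forall k, ok (h k)) -> ok (\sum_(k <- r) h k).
Proof. by move=> hh; elim/big_ind: _. Qed.

Lemma ok_sum2 W (h : 'I_n -> 'I_n -> E) :
  (forall k l, ok (h k l)) -> ok (\sum_k \sum_l W k l *: h k l).
Proof. by move=> hh; apply: ok_sum => k; apply: ok_sum => l; exact: okZ. Qed.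

Lemma ok_pairing W z : ok z -> ok (pairing W z).
Proof. by move=> zok; apply: ok_sum2 => k l; apply/ok_g/ok_u. Qed.

Lemma ok_power W m z : ok z -> ok (power W m z).
Proof. by move=> zok; elim: m => //= m; exact: ok_pairing. Qed.

Lemma ok_contr_bivector W z : ok z -> ok (contr_bivector u W z).
Proof. by move=> zok; apply/okZ/ok_sum2 => k l; do 2 apply: ok_u. Qed.

Lemma ok_contr_bivector' W z : ok z -> ok (contr_bivector g W z).
Proof. by move=> zok; apply/okZ/ok_sum2 => k l; do 2 apply: ok_g. Qed.

Lemma pairing_u W k z : ok z -> pairing W (u k z) = u k (pairing W z).
Proof.
move=> zok; rewrite /pairing linear_comb2; apply: eq_sum2 => p q.
by rewrite ug (uu k p zok) linearN opprK.
Qed.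

Lemma pairing_g W k z : ok z -> pairing W (g k z) = g k (pairing W z).
Proof.
move=> zok; rewrite /pairing linear_comb2; apply: eq_sum2 => p q.
by rewrite ug linearN gg ?opprK //; exact: ok_u.
Qed.

Lemma pairingC W W' z : ok z -> pairing W (pairing W' z) = pairing W' (pairing W z).
Proof.
move=> zok; rewrite [LHS](linear_comb2 (pairing W)).
by apply: eq_sum2 => k l /=; rewrite pairing_g ?pairing_u//; exact: ok_u.
Qed.

Lemma pairing_row W W' a z : ok z -> pairing W (contr_row u W' a z) =
  contr_row u W' a (pairing W z).
Proof.
move=> zok; rewrite /contr_row linear_sum; apply: eq_bigr => k _.
by rewrite linearZZ /= pairing_u.
Qed.

Lemma pairing_row' W W' a z : ok z -> pairing W (contr_row g W' a z) =
  contr_row g W' a (pairing W z).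
Proof.
move=> zok; rewrite /contr_row linear_sum; apply: eq_bigr => k _.
by rewrite linearZZ /= pairing_g.
Qed.

Lemma pairing_bivector W W' z : ok z -> pairing W (contr_bivector u W' z) =
  contr_bivector u W' (pairing W z).
Proof.
move=> zok; rewrite /contr_bivector linearZZ (linear_comb2 (pairing W)); congr (_ *: _).
by apply: eq_sum2 => k l /=; rewrite !pairing_u//; exact: ok_u.
Qed.

Lemma pairing_bivector' W W' z : ok z -> pairing W (contr_bivector g W' z) =
  contr_bivector g W' (pairing W z).
Proof.
move=> zok; rewrite /contr_bivector linearZZ (linear_comb2 (pairing W)); congr (_ *: _).
by apply: eq_sum2 => k l /=; rewrite !pairing_g//; exact: ok_g.
Qed.

Lemma power_comm W m (A : E -> E) :
  (forall z, ok z -> pairing W (A z) = A (pairing W z)) ->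
  forall z, ok z -> power W m (A z) = A (power W m z).
Proof.
move=> h z zok; elim: m => // m IH.
by rewrite -[LHS]/(pairing W (power W m (A z))) IH h//; exact: ok_power.
Qed.

(** The commutator of the pairing with a covector multiplication on one factor
is a contraction on the other factor. It is this contraction that matches the
first-order part of the codifferential in [deformed_leibniz]. *)
Lemma pairing_x W a z : pairing W (x a z) = x a (pairing W z) + contr_row g W a z.
Proof.
rewrite /pairing linear_comb2 addrC.
transitivity (\sum_k ((k == a)%:R *: (\sum_l W k l *: g l z) +
  \sum_l W k l *: x a (g l (u k z)))).
  apply: eq_bigr => k _; rewrite scaler_sumr -big_split; apply: eq_bigr => l _ /=.
  by rewrite ux linearB linearZZ gx opprK scalerDr !scalerA mulrC.
by rewrite big_split sum_delta.
Qed.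

Lemma pairing_y W a z : W^T = - W -> pairing W (y a z) = y a (pairing W z) + contr_row u W a z.
Proof.
move=> Wanti; rewrite /pairing linear_comb2 addrC exchange_big /=.
rewrite [X in _ = _ + X]exchange_big /=.
transitivity (\sum_l ((l == a)%:R *: (\sum_k - W k l *: u k z) +
  \sum_k W k l *: y a (g l (u k z)))).
  apply: eq_bigr => l _; rewrite scaler_sumr -big_split; apply: eq_bigr => k _ /=.
  rewrite uy linearN gy opprB scalerBr addrC !scalerA; congr (_ + _).
  by rewrite mulrN scaleNr mulrC.
rewrite big_split sum_delta /=; congr (_ + _); apply: eq_bigr => k _.
by have /matrixP/(_ a k) := Wanti; rewrite !mxE => ->; rewrite opprK.
Qed.

Lemma power_x W a m z : ok z ->
  power W m (x a z) = x a (power W m z) + m%:R *: contr_row g W a (power W m.-1 z).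
Proof.
move=> zok; case: m => [|m]; first by rewrite scale0r addr0.
elim: m => [|m IH]; first by rewrite /power /= pairing_x scale1r.
rewrite -[LHS]/(pairing W (power W m.+1 _)) IH linearD linearZZ /= pairing_x.
rewrite pairing_row'; last exact: ok_power.
by rewrite -addrA [m.+2%:R](natrD R 1 m.+1) scalerDl scale1r.
Qed.

Lemma power_y W a m z : W^T = - W -> ok z ->
  power W m (y a z) = y a (power W m z) + m%:R *: contr_row u W a (power W m.-1 z).
Proof.
move=> Wanti zok; case: m => [|m]; first by rewrite scale0r addr0.
elim: m => [|m IH]; first by rewrite /power /= pairing_y// scale1r.
rewrite -[LHS]/(pairing W (power W m.+1 _)) IH linearD linearZZ /= pairing_y//.
rewrite pairing_row; last exact: ok_power.
by rewrite -addrA [m.+2%:R](natrD R 1 m.+1) scalerDl scale1r.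
Qed.

Lemma mu_contr_row W a z : contr_row i W a (mu z) = mu (contr_row u W a z) +
  mu (contr_row g W a z).
Proof.
rewrite /contr_row !linear_sum -big_split; apply: eq_bigr => k _.
by rewrite mu_i !linearZZ scalerDr.
Qed.

(** As a differential operator w |- has order two: on a product it acts on
each factor and produces a cross term, which is minus the pairing. *)
Lemma mu_contr_bivector W z : W^T = - W ->
  contr_bivector i W (mu z) = mu (contr_bivector u W z) + mu (contr_bivector g W z) -
    mu (pairing W z).
Proof.
move=> Wanti.
have Wa k l : W k l = - W l k.
  by have /matrixP/(_ l k) := Wanti; rewrite !mxE.
have -> : pairing W z = - (2^-1 *: (\sum_k \sum_l W k l *: u k (g l z) +
                                    \sum_k \sum_l W k l *: g k (u l z))).
  rewrite [LHS]scale_half_double -scalerN opprD; congr (_ *: (_ + _)).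
    rewrite -sumrN; apply: eq_bigr => k _; rewrite -sumrN; apply: eq_bigr => l _.
    by rewrite ug scalerN opprK.
  rewrite /pairing exchange_big -sumrN; apply: eq_bigr => k _.
  by rewrite -sumrN; apply: eq_bigr => l _; rewrite [in LHS]Wa scaleNr.
rewrite linearN opprK /contr_bivector !linearZZ -!scalerDr; congr (_ *: _).
rewrite -!linearD -!big_split linear_sum; apply: eq_bigr => k _.
rewrite -!big_split linear_sum; apply: eq_bigr => l _ /=.
rewrite -!scalerDr linearZZ; congr (_ *: _).
rewrite mu_i linearD /= !mu_i !linearD /= -!addrA; congr (_ + _).
by rewrite addrC [mu (u k _) + _]addrC -addrA.
Qed.

Section Poisson.
Variables (W : 'M[R]_n) (dW : 'I_n -> 'M[R]_n).
Hypothesis W_anti : W^T = - W.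
Hypothesis dW_anti : forall a, (dW a)^T = - dW a.
Let t (j k l : 'I_n) := jacobiator W dW j k l.
Hypothesis jacobi : forall j k l, t j k l + t k l j + t l j k = 0.

Let t_anti j k l : t j k l = - t j l k. Proof. exact: jacobiator_anti. Qed.

(** Both sides are cubic in contractions with the coefficients of the
jacobiator. On the left they occur in the order in which W is contracted first,
on the right with a factor 1/2 and a cyclic shift of the indices; [cyclic_sum]
turns one into the other, separately for the terms with two contractions on
the left factor and for those with two on the right factor. *)
Lemma poisson_pairing z : ok z ->
  \sum_a (contr_row u W a (pairing (dW a) z) + contr_row g W a (pairing (dW a) z)) =
  \sum_a (contr_row g W a (contr_bivector u (dW a) z) +
    contr_row u W a (contr_bivector g (dW a) z)).
Proof.
move=> zok; rewrite !big_split /=.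
congr (_ + _).
  transitivity (- \sum_j \sum_k \sum_l t j k l *: u j (g l (u k z))).
    rewrite -sum_jacobiator//; apply: eq_bigr => a _; apply: eq_bigr => j _.
    by rewrite /pairing linear_comb2.
  rewrite (_ : \sum_j \sum_k \sum_l t j k l *: u j (g l (u k z)) =
     \sum_j \sum_k \sum_l t j k l *: - g l (u j (u k z))); last first.
    by do 3 (apply: eq_bigr => ? _); rewrite ug.
  rewrite (cyclic_sum t_anti jacobi) ?opprK => [|a b c]; last first.
    by rewrite (uu a b zok) linearN.
  transitivity (2^-1 *: - \sum_j \sum_k \sum_l t j k l *: g j (u k (u l z))).
    congr (_ *: _); rewrite [in RHS]exchange_big -sumrN; apply: eq_bigr => a _ /=.
    rewrite [in RHS]exchange_big -sumrN; apply: eq_bigr => b _ /=.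
    by rewrite -sumrN; apply: eq_bigr => c _; rewrite scalerN.
  rewrite -sum_jacobiator// scaler_sumr; apply: eq_bigr => a _.
  rewrite scaler_sumr; apply: eq_bigr => j _.
  by rewrite /contr_bivector (linearZZ (g j)) (linear_comb2 (g j)) !scalerA mulrC.
transitivity (- \sum_j \sum_k \sum_l t j k l *: g j (g l (u k z))).
  rewrite -sum_jacobiator//; apply: eq_bigr => a _; apply: eq_bigr => j _.
  by rewrite /pairing linear_comb2.
(* In this form the contractions are antisymmetric in the first two indices. *)
transitivity (\sum_j \sum_k \sum_l t j k l *: g j (g k (u l z))).
  rewrite -sumrN; apply: eq_bigr => j _; rewrite -sumrN exchange_big; apply: eq_bigr => l _.
  rewrite -sumrN; apply: eq_bigr => k _ /=.
  by rewrite -scaleNr -t_anti.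
rewrite (cyclic_sum t_anti jacobi) => [|a b c]; last first.
  by rewrite gg//; exact: ok_u.
transitivity (2^-1 *: - \sum_j \sum_k \sum_l t j k l *: u j (g k (g l z))).
  rewrite -scalerN; congr (_ *: - _).
  under eq_bigr do rewrite exchange_big /=.
  rewrite exchange_big /=; apply: eq_bigr => c _; apply: eq_bigr => a _.
  by apply: eq_bigr => b _; rewrite !ug (linearN (g a)) opprK.
rewrite -sum_jacobiator// scaler_sumr; apply: eq_bigr => a _.
rewrite scaler_sumr; apply: eq_bigr => j _.
by rewrite /contr_bivector (linearZZ (u j)) (linear_comb2 (u j)) !scalerA mulrC.
Qed.

(** The derivative of P^m z in the direction a when z has derivatives dz:
pairings commute with each other, so differentiating W gives m equal terms. *)
Definition dpower m z (dz : 'I_n -> E) a : E :=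
  power W m (dz a) + m%:R *: pairing (dW a) (power W m.-1 z).

(** The coefficient of h^m in the Leibniz rule, multiplied by m!. Here z is
the value of alpha # beta, and A, B are its derivatives that come from alpha
and from beta. *)
Theorem deformed_leibniz m z (A B : 'I_n -> E) (d := fun a => A a + B a) :
  ok z -> (forall a, ok (A a)) -> (forall a, ok (B a)) ->
  \sum_a e a (mu (dpower m z d a)) -
    m%:R *: koszul_jet i e W dW (mu (power W m.-1 z)) (fun a => mu (dpower m.-1 z d a)) =
  mu (power W m (\sum_a x a (A a))) + mu (power W m (\sum_a y a (B a))) -
  m%:R *: (mu (power W m.-1 (koszul_jet u x W dW z A)) +
    mu (power W m.-1 (koszul_jet g y W dW z B))).
Proof.
move=> zok Aok Bok; case: m => [|m].
  rewrite !scale0r !subr0 !linear_sum -big_split; apply: eq_bigr => a _ /=.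
  by rewrite /dpower scale0r addr0 /power /= !linearD mu_x mu_y.
rewrite /koszul_jet /=.
rewrite !(linearN (power W m)) !(linearN mu) -opprD !scalerN !opprK.
rewrite !(linear_sum (power W _)) !(linear_sum mu) -!big_split /= !scaler_sumr -!big_split /=.
apply/eqP; rewrite -subr_eq0 -sumrB; apply/eqP.
transitivity (m.+1%:R * m%:R *: mu
  (\sum_a ((contr_row u W a (pairing (dW a) (power W m.-1 z)) +
    contr_row g W a (pairing (dW a) (power W m.-1 z))) -
  (contr_row g W a (contr_bivector u (dW a) (power W m.-1 z)) +
    contr_row u W a (contr_bivector g (dW a) (power W m.-1 z)))))); last first.
  by rewrite sumrB poisson_pairing ?subrr ?linear0 ?scaler0//; exact: ok_power.
rewrite linear_sum scaler_sumr; apply: eq_bigr => a _.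
have zm := ok_power W m zok; have zm1 := ok_power W m.-1 zok.
have -> : dpower m.+1 z d a = power W m.+1 (A a) + power W m.+1 (B a) +
    m.+1%:R *: pairing (dW a) (power W m z) by rewrite /dpower linearD.
have -> : dpower m z d a = power W m (A a) + power W m (B a) +
    m%:R *: pairing (dW a) (power W m.-1 z) by rewrite /dpower linearD.
rewrite !power_x// power_y// mu_contr_row mu_contr_bivector//.
rewrite !(linearD (power W m)) /= !power_x ?power_y//;
  [|exact: ok_contr_bivector'|exact: ok_contr_bivector].
have pc := @power_comm W; have cu W' b z := @pairing_row W W' b z.
have cg W' b z := @pairing_row' W W' b z; have bu W' z := @pairing_bivector W W' z.
have bg W' z := @pairing_bivector' W W' z.
rewrite (pc _ _ (cu W a)) // (pc _ _ (cg W a)) // !(pc _ _ (bu (dW a))) // !(pc _ _ (bg (dW a)))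
  //.
move: (contr_bivector u (dW a) (power W m z)) (contr_bivector g (dW a) (power W m z)) => bz bz'.
move: (contr_bivector u (dW a) (power W m.-1 z)) (contr_bivector g (dW a) (power W m.-1 z)) =>
  by1 by1'.
rewrite !(linearD (contr_row u W a)) !(linearD (contr_row g W a)) !(linearZZ (contr_row u W a))
  !(linearZZ (contr_row g W a)) /=.
rewrite !(linearD mu) !(linearN mu) !(linearD mu) !(linearZZ mu) /= !mu_x !mu_y.
rewrite !(linearD (e a)) !(linearN (e a)) !(linearZZ (e a)) /=.
exact: leibniz_terms.
Qed.

End Poisson.

End DeformedLeibniz.

(** * Contractions, covector multiplication and the shuffle product *)

Lemma big_tuple_cons (S : nmodType) (T : finType) k (F : k.+1.-tuple T -> S) :
  \sum_t F t = \sum_x \sum_(t : k.-tuple T) F [tuple of x :: t].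
Proof.
rewrite pair_big /=.
rewrite (reindex (fun p : T * k.-tuple T => [tuple of p.1 :: p.2])) //=.
exists (fun t => (thead t, [tuple of behead t])).
  by move=> [x t] _ /=; rewrite theadE; congr pair; exact/val_inj.
by move=> t _ /=; rewrite [RHS]tuple_eta.
Qed.

(** An unselected entry put in front makes an inversion with each selected one. *)
Lemma inversions_cons k (b : bool) (m : k.-tuple bool) :
  inversions [tuple of b :: m] = ((~~ b) * count id m + inversions m)%N.
Proof.
rewrite /inversions big_ord_recl; congr addn.
  rewrite big_mkcond big_ord_recl /= add0n.
  have -> : count id m = (\sum_(i < k) tnth m i)%N.
    rewrite -sum1_count big_mkcond /= (big_nth false) size_tuple big_mkord.
    by apply: eq_bigr => i _; rewrite (tnth_nth false); case: nth.
  rewrite big_distrr /=; apply: eq_bigr => i _.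
  by rewrite tnthS; case: b => /=; rewrite ?mul0n ?mul1n.
apply: eq_bigr => i _; rewrite big_mkcond big_ord_recl /= add0n.
rewrite [RHS]big_mkcond; apply: eq_bigr => j _; rewrite !tnthS.
by rewrite /bump /= !add1n ltnS.
Qed.

Section MultiformOperators.
Variables (R : realType) (V : lmodType R).
Local Notation form := (seq V -> R^o).
Local Notation biform := (seq V -> seq V -> R^o).
Implicit Types (f g : form) (T : biform) (u v : V) (l : V -> R) (s t : seq V).

Definition contr v f : form := fun s => f (v :: s).

(** The exterior product of the covector l with f. *)
Definition cowedge l f : form := fun s =>
  \sum_(k < size s) (-1) ^+ k * l (nth 0 s k) * f (take k s ++ drop k.+1 s).

Definition contr1 v T : biform := fun s t => T (v :: s) t.
Definition contr2 v T : biform := fun s => contr v (T s).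
Definition cowedge1 l T : biform := fun s t => cowedge l (T^~ t) s.
Definition cowedge2 l T : biform := fun s => cowedge l (T s).
Definition sign1 T : biform := fun s t => (-1) ^+ size s * T s t.

(** The exterior product, extended from pairs of forms ([ext_prodE]) to functions
of two lists; being linear there, it can be composed with powers of the
pairing. *)
Definition shuffle T : form := fun s =>
  \sum_(m : (size s).-tuple bool)
    (-1) ^+ inversions m * T (mask m s) (mask (map negb m) s).

Definition tensor f g : biform := fun s t => f s * g t.

Lemma ext_prodE f g : ext_prod f g = shuffle (tensor f g).
Proof. by apply/funext => s; apply: eq_bigr => m _; rewrite /tensor mulrA. Qed.

Fact contr_linear v : linear (contr v). Proof. by []. Qed.
HB.instance Definition _ v := GRing.isLinear.Build R form form _ (contr v) (contr_linear v).
Fact contr1_linear v : linear (contr1 v). Proof. by []. Qed.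
HB.instance Definition _ v := GRing.isLinear.Build R biform biform _ (contr1 v) (contr1_linear v).
Fact contr2_linear v : linear (contr2 v). Proof. by []. Qed.
HB.instance Definition _ v := GRing.isLinear.Build R biform biform _ (contr2 v) (contr2_linear v).

Fact cowedge_linear l : linear (cowedge l).
Proof.
move=> r f g; apply/funext => s.
change (cowedge l (r *: f + g) s = r * cowedge l f s + cowedge l g s).
rewrite /cowedge mulr_sumr -big_split /=; apply: eq_bigr => k _.
rewrite [X in _ * X](_ : _ = r * f (take k s ++ drop k.+1 s) + g (take k s ++ drop k.+1 s)) //.
ring.
Qed.
HB.instance Definition _ l := GRing.isLinear.Build R form form _ (cowedge l) (cowedge_linear l).

Fact cowedge1_linear l : linear (cowedge1 l).
Proof.
move=> r f g; apply/funext => s; apply/funext => t.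
by have /(congr1 (@^~ s)) := cowedge_linear l r (f^~ t) (g^~ t).
Qed.
HB.instance Definition _ l := GRing.isLinear.Build R biform biform _ (cowedge1 l)
  (cowedge1_linear l).
Fact cowedge2_linear l : linear (cowedge2 l).
Proof.
move=> r f g; apply/funext => s; apply/funext => t.
by have /(congr1 (@^~ t)) := cowedge_linear l r (f s) (g s).
Qed.
HB.instance Definition _ l := GRing.isLinear.Build R biform biform _ (cowedge2 l)
  (cowedge2_linear l).
Fact sign1_linear : linear sign1.
Proof.
move=> r f g; apply/funext => s; apply/funext => t.
change ((-1) ^+ size s * (r * f s t + g s t) =
  r * ((-1) ^+ size s * f s t) + (-1) ^+ size s * g s t).
ring.
Qed.
HB.instance Definition _ := GRing.isLinear.Build R biform biform _ sign1 sign1_linear.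
Fact shuffle_linear : linear shuffle.
Proof.
move=> r f g; apply/funext => s.
change (shuffle (r *: f + g) s = r * shuffle f s + shuffle g s).
rewrite /shuffle mulr_sumr -big_split /=; apply: eq_bigr => m _.
rewrite [X in _ * X](_ : _ = r * f (mask m s) (mask (map negb m) s) +
  g (mask m s) (mask (map negb m) s)) //.
ring.
Qed.
HB.instance Definition _ := GRing.isLinear.Build R biform form _ shuffle shuffle_linear.

End MultiformOperators.

Section MultiformIdentities.
Variables (R : realType) (V : lmodType R).
Local Notation form := (seq V -> R^o).
Local Notation biform := (seq V -> seq V -> R^o).
Implicit Types (f g : form) (T : biform) (u v : V) (l : V -> R) (s t : seq V).

Lemma contr_cowedge v l f : contr v (cowedge l f) = l v *: f - cowedge l (contr v f).
Proof.
apply/funext => s.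
change (cowedge l f (v :: s) = l v * f s - cowedge l (contr v f) s).
rewrite /cowedge /= big_ord_recl /= drop0 expr0 mul1r; congr (_ + _).
rewrite -sumrN; apply: eq_bigr => k _.
by rewrite /bump /= add1n /= exprS mulN1r !mulNr.
Qed.

Lemma contr1_cowedge1 v l T : contr1 v (cowedge1 l T) = l v *: T - cowedge1 l (contr1 v T).
Proof.
by apply/funext => s; apply/funext => t; have /(congr1 (@^~ s)) := contr_cowedge v l (T^~ t).
Qed.

Lemma contr2_cowedge2 v l T : contr2 v (cowedge2 l T) = l v *: T - cowedge2 l (contr2 v T).
Proof. by apply/funext => s; exact: contr_cowedge. Qed.

Lemma sign1K T : sign1 (sign1 T) = T.
Proof. by apply/funext => s; apply/funext => t; rewrite /sign1 signrMK. Qed.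

Lemma contr1_sign1 v T : contr1 v (sign1 T) = - sign1 (contr1 v T).
Proof.
apply/funext => s; apply/funext => t.
change ((-1) ^+ (size s).+1 * T (v :: s) t = - ((-1) ^+ size s * T (v :: s) t)).
by rewrite exprS mulN1r mulNr.
Qed.

Lemma contr2_sign1 v T : contr2 v (sign1 T) = sign1 (contr2 v T). Proof. by []. Qed.

Lemma contr12C u v T : contr1 u (contr2 v T) = contr2 v (contr1 u T). Proof. by []. Qed.

Lemma cowedge1_sign1 l T : cowedge1 l (sign1 T) = - sign1 (cowedge1 l T).
Proof.
apply/funext => s; apply/funext => t.
change (cowedge1 l (sign1 T) s t = - ((-1) ^+ size s * cowedge1 l T s t)).
rewrite /cowedge1 /cowedge mulr_sumr -sumrN; apply: eq_bigr => k _.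
have szE : size (take k s ++ drop k.+1 s) = (k + (size s - k.+1))%N.
  by rewrite size_cat size_drop size_takel// ltnW.
rewrite /sign1 szE.
have -> : (-1) ^+ size s = - (-1) ^+ (k + (size s - k.+1)) :> R.
  have sE : size s = (k + (size s - k.+1)).+1 by rewrite -addnS subnSK// subnKC// ltnW.
  by rewrite [in LHS]sE exprS mulN1r.
rewrite mulNr opprK mulrCA; congr (_ * _); exact: mulrCA.
Qed.

Lemma cowedge2_sign1 l T : cowedge2 l (sign1 T) = sign1 (cowedge2 l T).
Proof.
apply/funext => s; apply/funext => t.
rewrite /sign1 /cowedge2 /cowedge mulr_sumr; apply: eq_bigr => k _.
by rewrite mulrCA.
Qed.

(** The graded Leibniz rule of contraction with the first slot holds for
arbitrary functions of lists: a mask of v :: s either selects v, or v jumps over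
the selected entries of s. *)
Lemma contr_shuffle v T : contr v (shuffle T) = shuffle (contr1 v T) +
  shuffle (sign1 (contr2 v T)).
Proof.
apply/funext => s.
change (shuffle T (v :: s) = shuffle (contr1 v T) s + shuffle (sign1 (contr2 v T)) s).
rewrite /shuffle /= big_tuple_cons.
rewrite big_bool; congr (_ + _); apply: eq_bigr => m _.
  by rewrite inversions_cons.
rewrite inversions_cons /= mul1n exprD /sign1 size_mask ?size_tuple// mulrA.
by rewrite [_ ^+ count _ _ * _]mulrC.
Qed.

Lemma shuffle_nil T : shuffle T [::] = T [::] [::].
Proof.
rewrite /shuffle (big_pred1 [tuple]) => [|m]; last first.
  by apply/esym/eqP/val_inj; exact: size0nil (size_tuple m).
by rewrite /inversions big_ord0 expr0 mul1r.
Qed.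

(** Contracting both sides with the first argument and using the graded
Leibniz rules leaves the same identities on a shorter list of arguments. *)
Lemma shuffle_cowedge l T : (shuffle (cowedge1 l T) = cowedge l (shuffle T)) *
  (shuffle (sign1 (cowedge2 l T)) = cowedge l (shuffle T)).
Proof.
suff H s T' : shuffle (cowedge1 l T') s = cowedge l (shuffle T') s /\
              shuffle (sign1 (cowedge2 l T')) s = cowedge l (shuffle T') s.
  by split; apply/funext => s; have [] := H s T.
elim: s T' => [|v s IH] {}T.
  rewrite !shuffle_nil /cowedge1 /sign1 /cowedge2 /cowedge !big_ord0.
  by rewrite mulr0.
have E1 : contr v (shuffle (cowedge1 l T)) =
    l v *: shuffle T - shuffle (cowedge1 l (contr1 v T)) -
      shuffle (cowedge1 l (sign1 (contr2 v T))).
  rewrite contr_shuffle contr1_cowedge1 (linearB (@shuffle R V)) (linearZZ (@shuffle R V)) /=;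
    congr (_ + _).
  by rewrite cowedge1_sign1 (linearN (@shuffle R V)) /= opprK.
have E2 : contr v (shuffle (sign1 (cowedge2 l T))) =
    l v *: shuffle T - shuffle (sign1 (cowedge2 l (contr1 v T))) -
      shuffle (sign1 (cowedge2 l (sign1 (contr2 v T)))).
  rewrite contr_shuffle contr1_sign1 (linearN (@shuffle R V)) /=.
  rewrite [contr2 v _](_ : _ = sign1 (contr2 v (cowedge2 l T))) // sign1K contr2_cowedge2.
  rewrite (linearB (@shuffle R V)) (linearZZ (@shuffle R V)) /= cowedge2_sign1 sign1K.
  by rewrite addrCA addrA.
have E3 : contr v (cowedge l (shuffle T)) =
    l v *: shuffle T - cowedge l (shuffle (contr1 v T)) -
      cowedge l (shuffle (sign1 (contr2 v T))).
  by rewrite contr_cowedge contr_shuffle linearD opprD addrA.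
rewrite -![_ (v :: s)]/(contr v _ s) E1 E2 E3.
have [I1 I2] := IH (contr1 v T); have [I3 I4] := IH (sign1 (contr2 v T)).
split.
  change (l v * shuffle T s - shuffle (cowedge1 l (contr1 v T)) s -
    shuffle (cowedge1 l (sign1 (contr2 v T))) s =
   l v * shuffle T s - cowedge l (shuffle (contr1 v T)) s -
     cowedge l (shuffle (sign1 (contr2 v T))) s).
  by rewrite I1 I3.
change (l v * shuffle T s - shuffle (sign1 (cowedge2 l (contr1 v T))) s -
  shuffle (sign1 (cowedge2 l (sign1 (contr2 v T)))) s =
   l v * shuffle T s - cowedge l (shuffle (contr1 v T)) s -
     cowedge l (shuffle (sign1 (contr2 v T))) s).
by rewrite I2 I4.
Qed.

End MultiformIdentities.

(** * Multilinear antisymmetric forms *)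

Section Antisymmetry.
Variables (R : realType) (V : lmodType R).
Local Notation form := (seq V -> R^o).
Local Notation biform := (seq V -> seq V -> R^o).
Implicit Types (f g : form) (T : biform) (u v : V) (l : V -> R) (s t : seq V).

(** Adjacent transpositions suit recursions on the list of arguments, where two
repeated arguments may be far apart. *)
Definition antisym f := forall s1 u v s2,
  f (s1 ++ u :: v :: s2) = - f (s1 ++ v :: u :: s2).

Definition is_form f := multilinear f /\ antisym f.

Definition is_biform T := (forall t, is_form (T^~ t)) /\ (forall s, is_form (T s)).

Lemma alternating_antisym f : multilinear f -> alternating_form f -> is_form f.
Proof.
move=> fl fa; split=> // s1 u v s2; apply/eqP; rewrite -addr_eq0; apply/eqP.
have E (x : V) r : f (s1 ++ (u + v) :: x :: r) = f (s1 ++ u :: x :: r) + f (s1 ++ v :: x :: r).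
  by have := fl s1 (x :: r) 1 u v; rewrite scale1r mul1r.
have E2 (x : V) : f (s1 ++ x :: (u + v) :: s2) = f (s1 ++ x :: u :: s2) + f (s1 ++ x :: v :: s2).
  by have := fl (rcons s1 x) s2 1 u v; rewrite scale1r mul1r !cat_rcons.
have := fa s1 [::] s2 (u + v); rewrite /= E !E2.
have /= -> := fa s1 [::] s2 u; have /= -> := fa s1 [::] s2 v.
by rewrite add0r addr0.
Qed.

Lemma is_form0 : is_form 0.
Proof.
split; first by move=> s1 s2 r u v; rewrite /= mulr0 addr0.
by move=> s1 u v s2; rewrite oppr0.
Qed.

Lemma is_formD f g : is_form f -> is_form g -> is_form (f + g).
Proof.
move=> [fl fa] [gl ga]; split.
  move=> s1 s2 r u v; have := fl s1 s2 r u v; have := gl s1 s2 r u v.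
  set x := (_ :: _); rewrite -![(f + g) _]/(f _ + g _) => -> ->; ring.
move=> s1 u v s2; rewrite -![(f + g) _]/(f _ + g _) fa ga; ring.
Qed.

Lemma is_formZ k f : is_form f -> is_form (k *: f).
Proof.
move=> [fl fa]; split.
  move=> s1 s2 r u v; have := fl s1 s2 r u v.
  set x := (_ :: _); rewrite -![(k *: f) _]/(k * f _) => ->; ring.
by move=> s1 u v s2; rewrite -![(k *: f) _]/(k * f _) fa mulrN.
Qed.

Lemma is_formN f : is_form f -> is_form (- f).
Proof. by rewrite -scaleN1r; exact: is_formZ. Qed.

Lemma is_form_sum (I : Type) (r : seq I) (P : pred I) (F : I -> form) :
  (forall i, P i -> is_form (F i)) -> is_form (\sum_(i <- r | P i) F i).
Proof.
by move=> h; elim/big_ind : _ => //; [exact: is_form0 | exact: is_formD].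
Qed.

Lemma is_form_contr v f : is_form f -> is_form (contr v f).
Proof. by move=> [fl fa]; split=> s1; [exact: (fl (v :: s1)) | exact: (fa (v :: s1))]. Qed.

Lemma is_form_contract_last v f : is_form f -> is_form (contract_last f v).
Proof.
move=> [fl fa]; split; first by move=> s1 s2 r u u'; rewrite /contract_last !rcons_cat; exact: fl.
by move=> s1 u u' s2; rewrite /contract_last !rcons_cat; exact: fa.
Qed.

Lemma contr_linear_arg f r u v : multilinear f -> contr (r *: u + v) f = r *: contr u f +
  contr v f.
Proof. by move=> fl; apply/funext => s; exact: (fl [::]). Qed.

Lemma contrC f u v : antisym f -> contr u (contr v f) = - contr v (contr u f).
Proof. by move=> fa; apply/funext => s; exact: (fa [::]). Qed.

Lemma cowedge_cons v l f s : cowedge l f (v :: s) = l v * f s - cowedge l (contr v f) s.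
Proof. by have /(congr1 (@^~ s)) := contr_cowedge v l f. Qed.

Lemma is_form_cowedge (l : {linear V -> R^o}) f : is_form f -> is_form (cowedge l f).
Proof.
move=> ff; split=> s1; elim: s1 f ff => [|x s1 IH] f ff.
- move=> s2 r u v; rewrite /= !cowedge_cons contr_linear_arg; last exact: ff.1.
  rewrite (linearP l) (linearP (cowedge l)) /=.
  change ((r * l u + l v) * f s2 - (r * cowedge l (contr u f) s2 + cowedge l (contr v f) s2) =
    r * (l u * f s2 - cowedge l (contr u f) s2) + (l v * f s2 - cowedge l (contr v f) s2)).
  ring.
- move=> s2 r u v; rewrite /= !cowedge_cons IH ?(ff.1 s1 s2 r u v); last exact: is_form_contr.
  ring.
- move=> u v s2; rewrite /= !cowedge_cons (contrC u v) ?(linearN (cowedge l)) /=;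
  last exact: ff.2.
  change (l u * f (v :: s2) - (l v * f (u :: s2) - cowedge l (contr v (contr u f)) s2) =
    - (l v * f (u :: s2) - (l u * f (v :: s2) - - cowedge l (contr v (contr u f)) s2))).
  ring.
- move=> u v s2; rewrite /= !cowedge_cons IH; last exact: is_form_contr.
  by rewrite ff.2; ring.
Qed.

Lemma contract_last_contr f v s : antisym f -> contract_last f v s = (-1) ^+ size s * contr v f s.
Proof.
rewrite /contract_last /contr => fa; elim: s f fa => [|x s IH] f fa.
  by rewrite /= expr0 mul1r.
have -> : f (rcons (x :: s) v) = (-1) ^+ size s * f (x :: v :: s).
  by apply: (IH (fun s => f (x :: s))) => s1; exact: (fa (x :: s1)).
by rewrite (fa [::]) /= exprS mulN1r mulrN mulNr.
Qed.

Lemma is_biform_tensor f g : is_form f -> is_form g -> is_biform (tensor f g).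
Proof.
move=> ff fg; split=> s.
  rewrite [X in is_form X](_ : _ = g s *: f); first exact: is_formZ.
  by apply/funext => t; rewrite /tensor mulrC.
by rewrite [X in is_form X](_ : _ = f s *: g); first exact: is_formZ.
Qed.

Lemma is_biform0 : is_biform 0.
Proof. by split=> s; exact: is_form0. Qed.
Lemma is_biformD T T' : is_biform T -> is_biform T' -> is_biform (T + T').
Proof. by move=> [? ?] [? ?]; split=> s; exact: is_formD. Qed.
Lemma is_biformZ k T : is_biform T -> is_biform (k *: T).
Proof. by move=> [? ?]; split=> s; exact: is_formZ. Qed.
Lemma is_biform_contr1 v T : is_biform T -> is_biform (contr1 v T).
Proof. by move=> [h1 h2]; split=> s; [exact: (is_form_contr v (h1 s)) | exact: h2]. Qed.
Lemma is_biform_contr2 v T : is_biform T -> is_biform (contr2 v T).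
Proof. by move=> [h1 h2]; split=> s; [exact: h1 | exact: (is_form_contr v (h2 s))]. Qed.
Lemma is_biform_sign1 T : is_biform T -> is_biform (sign1 T).
Proof.
move=> [h1 h2]; split=> s; last exact: is_formZ.
split.
  move=> s1 s2 r u v; rewrite /sign1 (h1 s).1 !size_cat /= mulrDr.
  by rewrite mulrCA.
by move=> s1 u v s2; rewrite /sign1 (h1 s).2 !size_cat /= mulrN.
Qed.

Lemma shuffle_cons v T s : shuffle T (v :: s) = shuffle (contr1 v T) s +
  shuffle (sign1 (contr2 v T)) s.
Proof. by have /(congr1 (@^~ s)) := contr_shuffle v T. Qed.

Lemma contr1_linear_arg T r u v : is_biform T -> contr1 (r *: u + v) T = r *: contr1 u T +
  contr1 v T.
Proof.
move=> [h _]; apply/funext => s; apply/funext => t.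
by have := contr_linear_arg r u v (h t).1 => /(congr1 (@^~ s)).
Qed.
Lemma contr2_linear_arg T r u v : is_biform T -> contr2 (r *: u + v) T = r *: contr2 u T +
  contr2 v T.
Proof. by move=> [_ h]; apply/funext => s; exact: contr_linear_arg (h s).1. Qed.
Lemma contr1C T u v : is_biform T -> contr1 u (contr1 v T) = - contr1 v (contr1 u T).
Proof.
by move=> [h _]; apply/funext => s; apply/funext => t; exact: ((h t).2 [::]).
Qed.
Lemma contr2C T u v : is_biform T -> contr2 u (contr2 v T) = - contr2 v (contr2 u T).
Proof. by move=> [_ h]; apply/funext => s; exact: contrC (h s).2. Qed.

Lemma is_form_shuffle T : is_biform T -> is_form (shuffle T).
Proof.
move=> fT; split=> s1; elim: s1 T fT => [|x s1 IH] T fT.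
- move=> s2 r u v; rewrite /= !shuffle_cons (contr1_linear_arg r u v fT)
  (contr2_linear_arg r u v fT).
  have muP X Y : shuffle (r *: X + Y) s2 = r * shuffle X s2 + shuffle Y s2.
    by have /(congr1 (@^~ s2)) := shuffle_linear r X Y.
  rewrite (sign1_linear r) !muP; ring.
- move=> s2 r u v; rewrite /= !shuffle_cons !IH; last 2 first.
  + exact/is_biform_sign1/is_biform_contr2.
  + exact/is_biform_contr1.
  ring.
- move=> u v s2.
  rewrite /= !shuffle_cons !contr2_sign1 !sign1K !contr1_sign1 (contr1C v u fT) (contr2C v u fT).
  rewrite (contr12C u v) (contr12C v u).
  have muN X : shuffle (- X) s2 = - shuffle X s2 by rewrite (linearN (@shuffle R V)).
  move: (contr1 u (contr1 v T)) (contr2 v (contr1 u T)) (contr2 u (contr1 v T)) => A B C.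
  move: (contr2 u (contr2 v T)) => D.
  rewrite !muN.
  move: (shuffle A s2) (shuffle D s2) (shuffle (sign1 B) s2) (shuffle (sign1 C) s2) => a d b c;
    ring.
- move=> u v s2; rewrite /= !shuffle_cons (IH (contr1 x T)); last exact: is_biform_contr1.
  rewrite (IH (sign1 (contr2 x T))); last exact/is_biform_sign1/is_biform_contr2.
  by rewrite -opprD.
Qed.

End Antisymmetry.

(** * Symmetry of second derivatives *)

Section SecondDerivatives.
Variables (R : realType) (V : normedModType R).
Implicit Types (f g : V -> R^o) (x u v : V).

Lemma near_eq_differentiable (W : normedModType R) (f g : V -> W) x :
  (\forall y \near x, f y = g y) -> differentiable f x -> differentiable g x.
Proof.
move=> fg df; have gx : g x = f x by rewrite (nbhs_singleton fg).
have E : g \o shift x = cst (g x) + 'd f x +o_ 0 id.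
  apply/eqaddoP => _/posnumP[e].
  have /diff_locally/eqaddoP/(_ _ [gt0 of e%:num]) := df.
  have : \forall h \near 0, f (h + x) = g (h + x).
    by move: fg; rewrite (near_shift 0 x) subr0.
  apply: filter_app2; near=> h => fgh.
  by rewrite -![(_ - _ : _ -> _) h]/(_ h - _ h) /= -fgh gx.
have dc := diff_continuous df.
by apply/diff_locallyP; rewrite (diff_unique dc E).
Unshelve. all: by end_near. Qed.

Lemma is_derive_line f x u (s : R) :
  derivable f (x + s *: u) u ->
  is_derive s 1 (fun t : R => f (x + t *: u) : R^o) ('D_u f (x + s *: u)).
Proof.
set l : R -> R^o := fun t => f (x + t *: u).
have E : (fun h : R => h^-1 *: ((l \o shift s) (h *: (1 : R)) - l s)) =
    (fun h : R => h^-1 *: ((f \o shift (x + s *: u)) (h *: u) - f (x + s *: u))).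
  by apply/funext => h; rewrite /l /= scalerDl addrCA scaler1.
by move=> df; split; rewrite /derivable /derive E.
Qed.

Definition second_difference f x u v (t : R) : R :=
  f (x + t *: v + t *: u) - f (x + t *: u) - (f (x + t *: v) - f x).

Lemma second_differenceC f x u v t : second_difference f x u v t = second_difference f x v u t.
Proof.
rewrite /second_difference [x + _ + _]addrAC !opprB !addrA.
by rewrite addrAC -!addrA; congr (_ + _); rewrite addrC -addrA [f x - _]addrC.
Qed.

(** By the mean value theorem the second difference is t times an increment of
D_u f, and the differentiability of D_u f at x evaluates that increment up to
a term that is small compared with t. *)
Lemma second_difference_near f x u v :
  (\forall y \near x, differentiable f y) -> differentiable ('D_u f) x ->
  forall e : R, 0 < e -> \forall t \near 0^'+,
    `|second_difference f x u v t - t ^+ 2 * 'D_v ('D_u f) x| <= e * t ^+ 2.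
Proof.
move=> df dg e e0; set g := 'D_u f in dg *.
set L := 'd g x.
(* The two points at which the increment is evaluated are s u + t v and s u with s <= t;
  their norms add up to at most K t. *)
pose K := 2 * `|u| + `|v| + 1.
have K0 : 0 < K by rewrite /K ltr_wpDl// addr_ge0// mulr_ge0.
have := dg => /diff_locally/eqaddoP/(_ (e / K) (divr_gt0 e0 K0)).
move=> /nbhs_normP[r1 /= r10 hr1].
have /nbhs_normP[r2 /= r20 hr2] := df.
pose r := Num.min r1 r2.
have r0 : 0 < r by rewrite lt_min r10 r20.
near=> t.
have t0 : 0 < t by near: t; exact: nbhs_right_gt.
have tr : t * K < r.
  by rewrite -ltr_pdivlMr//; near: t; apply: nbhs_right_lt; exact: divr_gt0.
have normc (s c : R) : 0 <= s <= t -> 0 <= c <= t ->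
    `|s *: u + c *: v| <= t * `|u| + c * `|v|.
  move=> /andP[s0 st] /andP[c0 _]; rewrite (le_trans (ler_normD _ _))//.
  by rewrite !normrZ !ger0_norm// lerD2r ler_wpM2r.
have small (s c : R) : 0 <= s <= t -> 0 <= c <= t -> `|s *: u + c *: v| < r.
  move=> /andP[s0 st] /andP[c0 ct]; apply: le_lt_trans tr.
  apply: le_trans (normc s c _ _) _; rewrite ?s0 ?c0//.
  rewrite /K !mulrDr mulr1.
  have h2 : c * `|v| <= t * `|v| by rewrite ler_wpM2r.
  have : 0 <= t * `|u| by rewrite mulr_ge0// ltW.
  lra.
have dfs (s c : R) : 0 <= s <= t -> 0 <= c <= t -> derivable f (x + c *: v + s *: u) u.
  move=> hs hc; apply: diff_derivable; apply: hr2.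
  rewrite /ball_/= -addrA opprD addrA subrr sub0r normrN [c *: v + _]addrC.
  by apply: (lt_le_trans (small _ _ hs hc)); rewrite ge_min lexx orbT.
have gs (s c : R) : 0 <= s <= t -> 0 <= c <= t ->
    `|g (x + c *: v + s *: u) - (g x + s * L u + c * L v)| <= e / K * `|s *: u + c *: v|.
  move=> hs hc; have := hr1 (s *: u + c *: v).
  rewrite /ball_/= sub0r normrN => /(_ (lt_le_trans (small _ _ hs hc) _)).
  rewrite ge_min lexx => /(_ isT).
  suff -> : (g \o +%R^~ x - (cst (g x) + 'd g x)) (s *: u + c *: v) =
    g (x + c *: v + s *: u) - (g x + s * L u + c * L v) by [].
  change (g (s *: u + c *: v + x) - (g x + L (s *: u + c *: v)) =
    g (x + c *: v + s *: u) - (g x + s * L u + c * L v)).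
  rewrite (linearD L) !(linearZZ L) addrA.
  by rewrite [s *: u + _ + x]addrC [s *: u + _]addrC addrA.
pose phi s : R := f (x + t *: v + s *: u) - f (x + s *: u).
pose dphi s : R := g (x + t *: v + s *: u) - g (x + s *: u).
have tt : 0 <= t <= t by rewrite lexx ltW.
have z0 : (0 : R) <= 0 <= t by rewrite lexx ltW.
have dphiP s : 0 <= s <= t -> is_derive s 1 phi (dphi s).
  move=> hs; apply: is_deriveB; apply: is_derive_line; first exact: dfs.
  by have := dfs s 0 hs z0; rewrite scale0r addr0.
have [s|s|s sI E] := @MVT R phi dphi 0 t t0.
- by rewrite in_itv /= => /andP[/ltW ? /ltW ?]; apply: dphiP; apply/andP.
- apply: derivable_within_continuous => {}s; rewrite in_itv /= => hs.
  by have [] := dphiP s hs.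
have {}sI : 0 <= s <= t by move: sI; rewrite in_itv /= => /andP[/ltW-> /ltW->].
have -> : second_difference f x u v t = dphi s * t.
  by rewrite -[X in _ * X]subr0 -E /phi /second_difference !scale0r !addr0.
have -> : 'D_v g x = L v by rewrite deriveE.
have -> : dphi s * t - t ^+ 2 * L v =
   ((g (x + t *: v + s *: u) - (g x + s * L u + t * L v)) -
    (g (x + 0 *: v + s *: u) - (g x + s * L u + 0 * L v))) * t.
  by rewrite /dphi scale0r addr0; ring.
rewrite normrM [ `|t|]gtr0_norm// expr2 mulrA (ler_wpM2r (ltW t0))//.
rewrite (le_trans (ler_normB _ _))//.
have g1 := gs s t sI tt; have g2 := gs s 0 sI z0.
apply: (le_trans (lerD g1 g2)); rewrite -mulrDr.
have -> : e * t = e / K * (K * t) by rewrite mulrA divfK// lt0r_neq0.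
rewrite ler_wpM2l//; first by rewrite divr_ge0// ltW.
have n1 := normc s t sI tt; have n2 := normc s 0 sI z0.
have : `|s *: u + t *: v| + `|s *: u + 0 *: v| <=
   t * `|u| + t * `|v| + (t * `|u| + 0 * `|v|) by exact: lerD.
move/le_trans; apply; rewrite /K; lra.
Unshelve. all: by end_near. Qed.

(** The second difference is symmetric in u and v, and t^-2 times it tends to
both mixed derivatives. *)
Lemma derive_comm f x u v :
  (\forall y \near x, differentiable f y) ->
  differentiable ('D_u f) x -> differentiable ('D_v f) x ->
  'D_v ('D_u f) x = 'D_u ('D_v f) x.
Proof.
move=> df du dv; apply/eqP; rewrite -subr_eq0 -normr_le0.
apply/ler_addgt0Pl => e e0; rewrite addr0.
have e2 : 0 < e / 2 by rewrite divr_gt0.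
have H1 := second_difference_near v df du e2.
have H2 := second_difference_near u df dv e2.
have H3 : \forall t \near (0 : R)^'+, 0 < t by exact: nbhs_right_gt.
have [t [[h1 h2] t0]] :=
  @filter_ex _ _ (at_right_proper_filter (0 : R)) _ (filterI (filterI H1 H2) H3).
have t2 : 0 < t ^+ 2 by rewrite exprn_gt0.
rewrite -(ler_pM2l t2) -{1}(gtr0_norm t2) -normrM.
rewrite second_differenceC in h1.
have := le_trans (ler_normB _ _) (lerD h2 h1).
move: (second_difference _ _ _ _ _) => D; rewrite opprB addrC addrA subrK.
rewrite -mulrBr => /le_trans; apply.
by rewrite -mulrDl -splitr mulrC.
Unshelve. all: by end_near. Qed.

End SecondDerivatives.

(** * Smooth functions on an open set *)

Section SmoothFunctions.
Variables (R : realType) (V : normedModType R) (U : set V).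
Hypothesis open_U : open U.
Implicit Types (f g : V -> R^o) (x v : V).

Lemma smooth_differentiable (W : normedModType R) (f : V -> W) x :
  smooth_on U f -> U x -> differentiable f x.
Proof. by move=> fs; exact: (fs [::]). Qed.

Lemma smooth_derive (W : normedModType R) (f : V -> W) v :
  smooth_on U f -> smooth_on U ('D_v f).
Proof. by move=> fs vs x Ux; have := fs (rcons vs v) x Ux; rewrite foldr_rcons. Qed.

(** Smoothness on U is the largest property of functions that implies
differentiability and is inherited by directional derivatives, up to equality
on U. *)
Lemma smooth_coind (S : (V -> R^o) -> Prop) :
  (forall f, S f -> (forall x, U x -> differentiable f x) /\
     forall v, exists2 g, S g & forall x, U x -> 'D_v f x = g x) ->
  forall f, S f -> smooth_on U f.
Proof.
move=> HS f Sf vs.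
suff H g : S g -> (forall x, U x -> f x = g x) ->
    forall x, U x -> differentiable (foldr (fun v g => 'D_v g) f vs) x by exact: H Sf _.
elim/last_ind: vs f g {Sf} => [|vs v IH] f g Sg fg x Ux /=.
  apply: (near_eq_differentiable _ ((HS _ Sg).1 x Ux)).
  by apply: filterS (open_nbhs_nbhs (conj open_U Ux)) => y /fg.
rewrite foldr_rcons; have [h Sh gh] := (HS _ Sg).2 v.
apply: (IH _ h) => // y Uy; rewrite -gh//; apply: near_eq_derive.
exact: filterS (open_nbhs_nbhs (conj open_U Uy)).
Qed.

Lemma derive_eq_on f g x v : (forall y, U y -> f y = g y) -> U x -> 'D_v f x = 'D_v g x.
Proof.
move=> fg Ux; apply: near_eq_derive.
exact: filterS (open_nbhs_nbhs (conj open_U Ux)).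
Qed.

Lemma eq_smooth f g : (forall x, U x -> f x = g x) -> smooth_on U f -> smooth_on U g.
Proof.
move=> fg fs.
apply: (@smooth_coind (fun g => exists2 f, smooth_on U f & forall x, U x -> f x = g x));
  last by exists f.
move=> {}g [{fg fs}f fs fg]; split=> [x Ux|v].
  apply: (near_eq_differentiable _ (smooth_differentiable fs Ux)).
  exact: filterS (open_nbhs_nbhs (conj open_U Ux)).
exists ('D_v f); first by exists ('D_v f); [exact: smooth_derive|].
by move=> x Ux; apply/esym/derive_eq_on.
Qed.

Lemma smoothD f g : smooth_on U f -> smooth_on U g -> smooth_on U (f + g).
Proof.
move=> fs gs.
apply: (@smooth_coind (fun h => exists f g, [/\ smooth_on U f, smooth_on U g & h = f + g]));
  last by exists f, g.
move=> {fs gs f g}_ [f [g [fs gs ->]]].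
have fd := smooth_differentiable fs; have gd := smooth_differentiable gs.
split=> [x Ux|v]; first by apply: differentiableD; [exact: fd|exact: gd].
exists ('D_v f + 'D_v g).
  by exists ('D_v f), ('D_v g); split => //; exact: smooth_derive.
by move=> x Ux; rewrite deriveD//; apply: diff_derivable; [exact: fd|exact: gd].
Qed.

(** The derivatives of a product are sums of products, which are again of this
form. *)
Inductive product_closure : (V -> R^o) -> Prop :=
| Product f g of smooth_on U f & smooth_on U g : product_closure (f * g)
| ProductD f g of product_closure f & product_closure g : product_closure (f + g).

Lemma smoothM f g : smooth_on U f -> smooth_on U g -> smooth_on U (f * g).
Proof.
move=> fs gs; apply: (@smooth_coind product_closure); last exact: Product.
move=> {fs gs f g}h; elim=> {h} [f g fs gs|f g _ [fd IHf] _ [gd IHg]].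
  have fd := smooth_differentiable fs; have gd := smooth_differentiable gs.
  split=> [x Ux|v]; first by apply: differentiableM; [exact: fd|exact: gd].
  exists (f * 'D_v g + g * 'D_v f).
    by apply: ProductD; apply: Product => //; exact: smooth_derive.
  by move=> x Ux; rewrite deriveM//; apply: diff_derivable; [exact: fd|exact: gd].
split=> [x Ux|v]; first by apply: differentiableD; [exact: fd|exact: gd].
have [f' Sf' f'E] := IHf v; have [g' Sg' g'E] := IHg v.
exists (f' + g'); first exact: ProductD.
move=> x Ux; rewrite deriveD//; last 2 first.
- by apply: diff_derivable; exact: fd.
- by apply: diff_derivable; exact: gd.
by rewrite f'E// g'E.
Qed.

Lemma smooth_cst (r : R) : smooth_on U (cst r : V -> R^o).
Proof.
apply: (@smooth_coind (fun g => exists r : R, g = cst r)); last by exists r.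
move=> _ [{}r ->]; split=> [x _|v]; first exact: differentiable_cst.
by exists (cst 0); [exists 0|move=> x Ux; rewrite derive_cst].
Qed.

Lemma smoothZ (r : R) f : smooth_on U f -> smooth_on U (r *: f).
Proof. by move=> fs; exact: (smoothM (smooth_cst r) fs). Qed.

Lemma smooth_sum (I : Type) (r : seq I) (P : pred I) (F : I -> V -> R^o) :
  (forall i, P i -> smooth_on U (F i)) -> smooth_on U (\sum_(i <- r | P i) F i).
Proof.
by move=> h; elim/big_ind: _ => //; [exact: (smooth_cst 0)|exact: smoothD].
Qed.

Lemma derive_entry m n (F : V -> 'M[R]_(m, n)) i j x v : differentiable F x ->
  'D_v (fun y => F y i j : R^o) x = 'D_v F x i j.
Proof.
move=> Fd; have Fv : derivable F x v by exact: diff_derivable.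
by rewrite (derive_mx Fv) mxE.
Qed.

Lemma smooth_entry m n (F : V -> 'M[R]_(m, n)) i j :
  smooth_on U F -> smooth_on U (fun x => F x i j : R^o).
Proof.
move=> Fs.
apply: (@smooth_coind (fun g => exists2 F : V -> 'M[R]_(m, n), smooth_on U F &
    g = fun x => F x i j)); last by exists F.
move=> _ [{Fs}F Fs ->]; have Fd := smooth_differentiable Fs; split=> [x Ux|v].
  exact: (differentiable_comp (Fd x Ux) (differentiable_coord (F x) i j)).
exists (fun x => 'D_v F x i j); first by exists ('D_v F) => //; exact: smooth_derive.
by move=> x Ux; rewrite derive_entry//; exact: Fd.
Qed.

End SmoothFunctions.

(** * Coordinate operators and independence of the frame *)

Section Coordinates.
Variables (R : realType) (n : nat).
Local Notation V := 'rV[R]_n.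
Local Notation form := (seq V -> R^o).
Local Notation biform := (seq V -> seq V -> R^o).
Implicit Types (f g : form) (T : biform) (W : 'M[R]_n) (v : V) (a k : 'I_n).

Definition bvec k : V := delta_mx 0 k.

Definition dual_coord a (v : V) : R^o := v 0 a.
Fact dual_coord_linear a : linear (dual_coord a).
Proof. by move=> r u v; rewrite /dual_coord !mxE. Qed.
HB.instance Definition _ a := GRing.isLinear.Build R V R^o _ (dual_coord a) (dual_coord_linear a).

Lemma dual_coord_bvec k a : dual_coord a (bvec k) = (k == a)%:R.
Proof. by rewrite /dual_coord /bvec mxE eqxx eq_sym. Qed.

Definition contr_bv k : {linear form -> form} := contr (bvec k).
Definition wedge_dx a : {linear form -> form} := cowedge (dual_coord a).
Definition contr_l k : {linear biform -> biform} := contr1 (bvec k).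
Definition wedge_l a : {linear biform -> biform} := cowedge1 (dual_coord a).
(** The sign of the left factor makes the operators on the right factor
anticommute with those on the left factor. *)
Definition contr_r k : {linear biform -> biform} := @sign1 R V \o contr2 (bvec k).
Definition wedge_r a : {linear biform -> biform} := @sign1 R V \o cowedge2 (dual_coord a).
Definition shuffle_lin : {linear biform -> form} := @shuffle R V.

Lemma contr_lE k T : contr_l k T = contr1 (bvec k) T. Proof. by []. Qed.
Lemma wedge_lE a T : wedge_l a T = cowedge1 (dual_coord a) T. Proof. by []. Qed.
Lemma is_biform_contr_l k T : is_biform T -> is_biform (contr_l k T).
Proof. exact: is_biform_contr1. Qed.
Lemma is_biform_contr_r k T : is_biform T -> is_biform (contr_r k T).
Proof. by move=> h; exact/is_biform_sign1/is_biform_contr2. Qed.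
Lemma contr_lC k l T : is_biform T -> contr_l k (contr_l l T) = - contr_l l (contr_l k T).
Proof. exact: contr1C. Qed.
Lemma contr_rE k T : contr_r k T = sign1 (contr2 (bvec k) T). Proof. by []. Qed.
Lemma wedge_rE k T : wedge_r k T = sign1 (cowedge2 (dual_coord k) T). Proof. by []. Qed.
Lemma contr_rC k l T : is_biform T -> contr_r k (contr_r l T) = - contr_r l (contr_r k T).
Proof. by move=> h; rewrite !contr_rE !contr2_sign1 !sign1K; exact: contr2C. Qed.
Lemma contr_lrC k l T : contr_l k (contr_r l T) = - contr_r l (contr_l k T).
Proof. by rewrite !contr_rE !contr_lE contr1_sign1. Qed.
Lemma contr_l_wedge_l k a T : contr_l k (wedge_l a T) = (k == a)%:R *: T -
  wedge_l a (contr_l k T).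
Proof. by rewrite [LHS]contr1_cowedge1 dual_coord_bvec. Qed.
Lemma contr_r_wedge_r k a T : contr_r k (wedge_r a T) = (k == a)%:R *: T -
  wedge_r a (contr_r k T).
Proof.
by rewrite !contr_rE !wedge_rE contr2_sign1 sign1K contr2_cowedge2 dual_coord_bvec cowedge2_sign1
  sign1K.
Qed.
Lemma contr_l_wedge_r k a T : contr_l k (wedge_r a T) = - wedge_r a (contr_l k T).
Proof. by rewrite !wedge_rE !contr_lE contr1_sign1. Qed.
Lemma contr_r_wedge_l k a T : contr_r k (wedge_l a T) = - wedge_l a (contr_r k T).
Proof. by rewrite !contr_rE !wedge_lE cowedge1_sign1 opprK. Qed.
Lemma contr_bv_shuffle k T : contr_bv k (shuffle_lin T) = shuffle_lin (contr_l k T) +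
  shuffle_lin (contr_r k T).
Proof. exact: contr_shuffle. Qed.
Lemma shuffle_wedge_l a T : shuffle_lin (wedge_l a T) = wedge_dx a (shuffle_lin T).
Proof. exact: (shuffle_cowedge (dual_coord a) T).1. Qed.
Lemma shuffle_wedge_r a T : shuffle_lin (wedge_r a T) = wedge_dx a (shuffle_lin T).
Proof. exact: (shuffle_cowedge (dual_coord a) T).2. Qed.
Lemma contr_bvC k l f : is_form f -> contr_bv k (contr_bv l f) = - contr_bv l (contr_bv k f).
Proof. by move=> [_ h]; exact: contrC. Qed.
Lemma contr_bv_wedge_dx k a f : contr_bv k (wedge_dx a f) = (k == a)%:R *: f -
  wedge_dx a (contr_bv k f).
Proof. by rewrite [LHS]contr_cowedge dual_coord_bvec. Qed.

Definition contr_w := @contr_bivector R n form contr_bv.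
Definition qpairing := @pairing R n biform contr_l contr_r.
Definition qpower := @power R n biform contr_l contr_r.
Definition koszul_bv := @koszul_jet R n form contr_bv wedge_dx.

Lemma is_form_contr_w W f : is_form f -> is_form (contr_w W f).
Proof.
move=> h; apply/is_formZ/is_form_sum => k _; apply: is_form_sum => l _.
by apply/is_formZ; do 2 apply: is_form_contr.
Qed.

Lemma is_form_wedge_dx a f : is_form f -> is_form (wedge_dx a f).
Proof. exact: (@is_form_cowedge R V (dual_coord a)). Qed.

Lemma is_biform_qpower W m T : is_biform T -> is_biform (qpower W m T).
Proof.
apply: ok_power; [exact: is_biform0|exact: is_biformD|exact: is_biformZ|..].
  exact: is_biform_contr_l.
exact: is_biform_contr_r.
Qed.

Lemma linear_comb (E E' : lmodType R) (h : E -> E') (c : 'I_n -> R) (z : 'I_n -> E) :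
  linear h -> h (\sum_a c a *: z a) = \sum_a c a *: h (z a).
Proof.
move=> hl; pose H : {linear E -> E'} := HB.pack h (GRing.isLinear.Build R E E' _ h hl).
rewrite -[h]/(H : E -> E') linear_sum; apply: eq_bigr => a _; exact: linearZZ.
Qed.

(** Expanding the vectors of a frame F in the standard basis changes the
coefficients C into F^T C F; for the components of w in the frame this gives back
its components in the coordinates ([frame_compK]). *)
Lemma frame_sum (E : lmodType R) (B : V -> V -> E) (C F : 'M[R]_n) :
  (forall v, linear (B^~ v)) -> (forall u, linear (B u)) ->
  \sum_k \sum_l C k l *: B (row k F) (row l F) =
  \sum_a \sum_b (F^T *m C *m F) a b *: B (bvec a) (bvec b).
Proof.
move=> B1 B2.
have rowE k : row k F = \sum_a F k a *: bvec a.
  by rewrite [LHS]row_sum_delta; apply: eq_bigr => a _; rewrite mxE.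
have BE k l : B (row k F) (row l F) = \sum_a \sum_b (F k a * F l b) *: B (bvec a) (bvec b).
  rewrite rowE (linear_comb _ _ (B1 _)); apply: eq_bigr => a _.
  rewrite rowE (linear_comb _ _ (B2 _)) scaler_sumr; apply: eq_bigr => b _.
  by rewrite scalerA.
under eq_bigr => k _.
  under eq_bigr => l _.
    rewrite BE scaler_sumr; under eq_bigr => a _.
      rewrite scaler_sumr; under eq_bigr do rewrite scalerA; over.
    over.
  rewrite exchange_big /=; under eq_bigr do rewrite exchange_big /=; over.
rewrite exchange_big /=; apply: eq_bigr => a _.
rewrite exchange_big /=; apply: eq_bigr => b _.
under eq_bigr do rewrite -scaler_suml; rewrite -scaler_suml; congr (_ *: _).
rewrite mxE exchange_big /=; apply: eq_bigr => l _.
rewrite mxE big_distrl /=; apply: eq_bigr => k _; rewrite mxE; ring.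
Qed.

Lemma frame_compK W (F : 'M[R]_n) : F \in unitmx ->
  F^T *m ((invmx F)^T *m W *m invmx F) *m F = W.
Proof.
move=> Fu; rewrite !mulmxA -trmx_mul mulVmx// trmx1 mul1mx -mulmxA mulVmx//.
by rewrite mulmx1.
Qed.

End Coordinates.

(** * First-order jets of forms *)

Section Jets.
Variables (R : realType) (n : nat).
Local Notation V := 'rV[R]_n.
Local Notation form := (seq V -> R^o).
Local Notation biform := (seq V -> seq V -> R^o).
Variable x : V.
Implicit Types (f g : V -> form) (T : V -> biform) (W : V -> 'M[R]_n) (v : V) (a k : 'I_n).

Lemma is_diff_bigsum (I : Type) (r : seq I) (F F' : I -> V -> R^o) :
  (forall i, is_diff x (F i) (F' i)) ->
  is_diff x (fun y => \sum_(i <- r) F i y : R^o) (fun v => \sum_(i <- r) F' i v).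
Proof.
move=> h; elim: r => [|i r IH].
  have -> : (fun y => \sum_(i <- [::]) F i y) = cst 0 by apply/funext => y; rewrite big_nil.
  have -> : (fun y => \sum_(i <- [::]) F' i y) = 0 by apply/funext => y; rewrite big_nil.
  exact: is_diff_cst.
have -> : (fun y => \sum_(i <- i :: r) F i y) = F i + (fun y => \sum_(i <- r) F i y).
  by apply/funext => y; rewrite big_cons.
have -> : (fun y => \sum_(i <- i :: r) F' i y) = F' i + (fun y => \sum_(i <- r) F' i y).
  by apply/funext => y; rewrite big_cons.
exact: is_diffD.
Qed.

(** The derivative is recorded as a function of the direction with values in
forms, because the jet operators of the preceding part take such values. *)
Definition form_is_diff f f' := forall s, is_diff x (fun y => f y s : R^o) (fun v => f' v s).
Definition biform_is_diff T T' := forall s, form_is_diff (fun y => T y s) (fun v => T' v s).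

Lemma form_is_diff_sum (I : Type) (r : seq I) (F F' : I -> V -> form) :
  (forall i, form_is_diff (F i) (F' i)) ->
  form_is_diff (fun y => \sum_(i <- r) F i y) (fun v => \sum_(i <- r) F' i v).
Proof.
move=> h s; have E (G : I -> V -> form) :
    (fun y => (\sum_(i <- r) G i y) s) = (fun y => \sum_(i <- r) G i y s).
  by apply/funext => y; rewrite fct_sumE.
by rewrite !E; apply: is_diff_bigsum => i; exact: h.
Qed.

Lemma biform_is_diff_sum (I : Type) (r : seq I) (F F' : I -> V -> biform) :
  (forall i, biform_is_diff (F i) (F' i)) ->
  biform_is_diff (fun y => \sum_(i <- r) F i y) (fun v => \sum_(i <- r) F' i v).
Proof.
move=> h s; have E (G : I -> V -> biform) :
    (fun y => (\sum_(i <- r) G i y) s) = (fun y => \sum_(i <- r) G i y s).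
  by apply/funext => y; rewrite fct_sumE.
by rewrite !E; apply: form_is_diff_sum => i; exact: h.
Qed.

Lemma form_is_diff_scale (r r' : V -> R^o) f f' : is_diff x r r' -> form_is_diff f f' ->
  form_is_diff (fun y => r y *: f y) (fun v => r' v *: f x + r x *: f' v).
Proof.
move=> hr hf s.
have := @is_diffM _ _ r (fun y => f y s) r' (fun v => f' v s) x hr (hf s).
move=> H; apply: (is_diff_eq H); apply/funext => v.
by rewrite addrC; congr (_ + _); exact: mulrC.
Qed.

Lemma form_is_diffZ (r : R) f f' : form_is_diff f f' ->
  form_is_diff (fun y => r *: f y) (fun v => r *: f' v).
Proof. by move=> hf s; exact: (is_diffZ r (hf s)). Qed.

Lemma biform_is_diff_scale (r r' : V -> R^o) T T' : is_diff x r r' -> biform_is_diff T T' ->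
  biform_is_diff (fun y => r y *: T y) (fun v => r' v *: T x + r x *: T' v).
Proof. by move=> hr hf s; exact: form_is_diff_scale (hf s). Qed.

Lemma form_is_diff_contr u f f' : form_is_diff f f' ->
  form_is_diff (fun y => contr u (f y)) (fun v => contr u (f' v)).
Proof. by move=> hf s; exact: hf. Qed.

Lemma biform_is_diff_contr1 u T T' : biform_is_diff T T' ->
  biform_is_diff (fun y => contr1 u (T y)) (fun v => contr1 u (T' v)).
Proof. by move=> hf s; exact: hf. Qed.

Lemma biform_is_diff_contr2 u T T' : biform_is_diff T T' ->
  biform_is_diff (fun y => contr2 u (T y)) (fun v => contr2 u (T' v)).
Proof. by move=> hf s; apply: form_is_diff_contr; exact: hf. Qed.

Lemma biform_is_diff_sign1 T T' : biform_is_diff T T' ->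
  biform_is_diff (fun y => sign1 (T y)) (fun v => sign1 (T' v)).
Proof. by move=> hf s; apply: (@form_is_diffZ _ (fun y => T y s) (fun v => T' v s));
  exact: hf. Qed.

Lemma form_is_diff_shuffle T T' : biform_is_diff T T' ->
  form_is_diff (fun y => shuffle (T y)) (fun v => shuffle (T' v)).
Proof.
move=> hT s; apply: is_diff_bigsum => m.
exact: (is_diffZ _ (hT _ _)).
Qed.

Lemma biform_is_diff_tensor f f' g g' : form_is_diff f f' -> form_is_diff g g' ->
  biform_is_diff (fun y => tensor (f y) (g y))
    (fun v => tensor (f' v) (g x) + tensor (f x) (g' v)).
Proof. by move=> hf hg s; exact: (form_is_diff_scale (hf s) hg). Qed.

Definition mx_is_diff W (W' : V -> 'M[R]_n) :=
  forall k l, is_diff x (fun y => W y k l : R^o) (fun v => W' v k l).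

Lemma biform_is_diff_pairing W W' T T' : mx_is_diff W W' -> biform_is_diff T T' ->
  biform_is_diff (fun y => qpairing (W y) (T y))
    (fun v => qpairing (W' v) (T x) + qpairing (W x) (T' v)).
Proof.
move=> hW hT.
have -> : (fun v => qpairing (W' v) (T x) + qpairing (W x) (T' v)) = (fun v => \sum_k \sum_l
    (W' v k l *: contr_r R l (contr_l R k (T x)) + W x k l *: contr_r R l (contr_l R k (T' v)))).
  apply/funext => v; rewrite -big_split; apply: eq_bigr => k _.
  by rewrite -big_split.
apply: biform_is_diff_sum => k; apply: biform_is_diff_sum => l.
apply: (biform_is_diff_scale (hW k l)); apply: biform_is_diff_sign1;
  apply: biform_is_diff_contr2; exact: biform_is_diff_contr1.
Qed.

Lemma form_is_diff_contr_w W W' f f' : mx_is_diff W W' -> form_is_diff f f' ->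
  form_is_diff (fun y => contr_w (W y) (f y))
    (fun v => contr_w (W' v) (f x) + contr_w (W x) (f' v)).
Proof.
move=> hW hf.
have -> : (fun v => contr_w (W' v) (f x) + contr_w (W x) (f' v)) = (fun v => 2^-1 *: \sum_k \sum_l
    (W' v k l *: contr_bv R k (contr_bv R l (f x)) +
      W x k l *: contr_bv R k (contr_bv R l (f' v)))).
  apply/funext => v; rewrite -scalerDr -big_split; congr (_ *: _); apply: eq_bigr => k _.
  by rewrite -big_split.
apply: form_is_diffZ; apply: form_is_diff_sum => k; apply: form_is_diff_sum => l.
by apply: (form_is_diff_scale (hW k l)); do 2 apply: form_is_diff_contr.
Qed.

(** The inductive step for the derivative of a power of the pairing: the new
derivative of the bivector is moved past the other pairings. *)
Lemma qpairing_qpower_jet (w w' : 'M[R]_n) m (t t' : biform) : is_biform t ->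
  qpairing w' (qpower w m t) + qpairing w (qpower w m t' + m%:R *: qpairing w' (qpower w m.-1 t))
    =
  qpower w m.+1 t' + m.+1%:R *: qpairing w' (qpower w m t).
Proof.
move=> ht.
have PD A B : qpairing w (A + B) = qpairing w A +
  qpairing w B by exact: (linearD (pairing (@contr_l R n) (@contr_r R n) w)).
have PZ r A : qpairing w (r *: A) =
  r *: qpairing w A by exact: (linearZZ (pairing (@contr_l R n) (@contr_r R n) w)).
rewrite (PD (qpower w m t') (m%:R *: qpairing w' (qpower w m.-1 t)))
  (PZ m%:R (qpairing w' (qpower w m.-1 t))).
have -> : m%:R *: qpairing w (qpairing w' (qpower w m.-1 t)) = m%:R *: qpairing w' (qpower w m t).
  case: m => [|m]; first by rewrite !scale0r.
  suff -> : qpairing w (qpairing w' (qpower w m t)) =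
    qpairing w' (qpairing w (qpower w m t)) by [].
  apply: (@pairingC R n _ _ _ (@is_biform R V)).
  - exact: is_biform_contr_l.
  - exact: contr_lC.
  - exact: contr_rC.
  - exact: contr_lrC.
  - exact: is_biform_qpower.
have -> : qpairing w (qpower w m t') = qpower w m.+1 t' by [].
move: (qpairing w' (qpower w m t)) (qpower w m.+1 t') => a b.
by rewrite addrCA -[m.+1]add1n natrD scalerDl scale1r.
Qed.

Lemma biform_is_diff_power W W' m T T' : mx_is_diff W W' -> biform_is_diff T T' ->
  is_biform (T x) ->
  biform_is_diff (fun y => qpower (W y) m (T y))
        (fun v => qpower (W x) m (T' v) + m%:R *: qpairing (W' v) (qpower (W x) m.-1 (T x))).
Proof.
move=> hW hT okT.
pose J m v := qpower (W x) m (T' v) + m%:R *: qpairing (W' v) (qpower (W x) m.-1 (T x)).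
rewrite -[X in biform_is_diff _ X]/(J m); elim: m => [|m IH].
  suff -> : J 0 = T' by exact: hT.
  by apply/funext => v; rewrite /J scale0r addr0.
have -> : J m.+1 = (fun v => qpairing (W' v) (qpower (W x) m (T x)) + qpairing (W x) (J m v)).
  by apply/funext => v; exact/esym/qpairing_qpower_jet.
exact: (biform_is_diff_pairing hW IH).
Qed.

End Jets.

(** * The quantum product as a power of the pairing *)

Section QuantumTerm.
Variables (R : realType) (n : nat).
Local Notation V := 'rV[R]_n.
Local Notation form := (seq V -> R^o).

Lemma big_tuple_nil (S : nmodType) (T : finType) (F : 0.-tuple T -> S) :
  \sum_t F t = F [tuple of [::]].
Proof.
rewrite (big_pred1 [tuple of [::]]) // => t.
by apply/esym/eqP/val_inj; exact: size0nil (size_tuple t).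
Qed.

Lemma tensor_frame (W E : 'M[R]_n) (a b : form) : E \in unitmx -> is_form a -> is_form b ->
  \sum_k \sum_l ((invmx E)^T *m W *m invmx E) k l *:
     tensor (contract_last a (row k E)) (contract_first b (row l E)) =
  qpairing W (tensor a b).
Proof.
move=> Eu fa fb.
rewrite (@frame_sum R n (seq V -> seq V -> R^o)
  (fun u v => tensor (contract_last a u) (contract_first b v))).
- rewrite frame_compK//; apply: eq_bigr => k _; apply: eq_bigr => l _; congr (_ *: _).
  apply/funext => s; apply/funext => t.
  by rewrite /tensor (contract_last_contr _ _ fa.2) -mulrA.
- move=> v r u u'; apply/funext => s; apply/funext => t.
  have h := fa.1 s [::] r u u'; rewrite !cats1 in h.
  rewrite /tensor /contract_last h mulrDl -mulrA; reflexivity.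
- move=> u r v v'; apply/funext => s; apply/funext => t.
  have h := fb.1 [::] t r v v'.
  change (contract_last a u s * b ((r *: v + v') :: t) =
    r * (contract_last a u s * b (v :: t)) + contract_last a u s * b (v' :: t)).
  rewrite (_ : b _ = r * b (v :: t) + b (v' :: t)) //; ring.
Qed.

(** Each pair of indices stands for one application of the pairing, and the
contractions by the first pair of indices are done first, so the induction peels
off the first entries of both tuples. *)
Lemma qterm_shuffle m (W E : 'M[R]_n) (a b : form) (C := (invmx E)^T *m W *m invmx E) :
  E \in unitmx -> is_form a -> is_form b ->
  \sum_(I : m.-tuple 'I_n) \sum_(J : m.-tuple 'I_n)
    (\prod_(k < m) C (tnth I k) (tnth J k)) *:
    (ext_prod (foldl (@contract_last R V) a [seq row i E | i <- I])
              (foldl (@contract_first R V) b [seq row i E | i <- J]) : form) =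
  shuffle (qpower W m (tensor a b)).
Proof.
move=> Eu; elim: m a b => [|m IH] a b fa fb.
  by rewrite big_tuple_nil big_tuple_nil big_ord0 scale1r /= ext_prodE.
have PmS z : qpower W m.+1 z = qpower W m (qpairing W z) by rewrite /qpower /power iterSr.
rewrite PmS -(tensor_frame _ Eu fa fb).
rewrite big_tuple_cons; under eq_bigr => i _.
  under eq_bigr => I _ do rewrite big_tuple_cons.
  rewrite exchange_big /=; over.
have lin := linear_comb2 (@shuffle_lin R n \o @power R n _ (@contr_l R n) (@contr_r R n) W m).
rewrite [RHS]lin; apply: eq_bigr => i _; apply: eq_bigr => j _.
rewrite -[RHS]/(C i j *: shuffle (qpower W m
  (tensor (contract_last a (row i E)) (contract_first b (row j E))))).
rewrite -IH; last 2 first.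
- exact: is_form_contract_last.
- exact: is_form_contr.
rewrite scaler_sumr; apply: eq_bigr => I _; rewrite scaler_sumr; apply: eq_bigr => J _.
rewrite big_ord_recl scalerA !tnth0 /=; congr (_ * _ *: _).
by apply: eq_bigr => k _; rewrite !tnthS.
Qed.

End QuantumTerm.

(** * Forms in a chart *)

Section LocalForms.
Variables (R : realType) (n : nat).
Local Notation V := 'rV[R]_n.
Local Notation form := (seq V -> R^o).
Variable U : set V.
Hypothesis open_U : open U.
Implicit Types (f : V -> form) (x v : V).

Definition jet f x v : form := fun s => 'D_v (fun y => f y s : R^o) x.

(** First-order differentiability suffices for the Leibniz rule. *)
Definition regular f :=
  (forall x, U x -> is_form (f x)) /\
  (forall s x, U x -> differentiable (fun y => f y s : R^o) x).

Lemma is_diff_derive (g : V -> R^o) x : differentiable g x ->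
  is_diff x g (fun v => 'D_v g x).
Proof. by move=> dg; split=> //; apply/funext => v; rewrite deriveE. Qed.

Lemma form_is_diff_jet f x : regular f -> U x -> form_is_diff x f (jet f x).
Proof. by move=> [_ df] Ux s; apply: is_diff_derive; exact: df. Qed.

Lemma jet_form_is_diff f x f' v : form_is_diff x f f' -> jet f x v = f' v.
Proof.
move=> h; apply/funext => s; have [ds vs] := h s.
by rewrite /jet deriveE// vs.
Qed.

Lemma is_form_jet f x v : regular f -> U x -> is_form (jet f x v).
Proof.
move=> [ff df] Ux.
have dv s : derivable (fun y => f y s : R^o) x v by apply: diff_derivable; exact: df.
split.
  move=> s1 s2 r u u'; rewrite /jet.
  rewrite (@derive_eq_on R V U open_U _
    (r *: (fun y => f y (s1 ++ u :: s2) : R^o) + (fun y => f y (s1 ++ u' :: s2) : R^o)))//.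
    by rewrite deriveD ?deriveZ//; exact: derivableZ.
  by move=> y Uy; exact: (ff y Uy).1.
move=> s1 u u' s2; rewrite /jet.
rewrite (@derive_eq_on R V U open_U _ (- (fun y => f y (s1 ++ u' :: u :: s2) : R^o)))//.
  by rewrite deriveN.
by move=> y Uy; exact: (ff y Uy).2.
Qed.

Lemma derive_sum_coord (g : V -> R^o) x v : differentiable g x ->
  'D_v g x = \sum_a v 0 a * 'D_(bvec R a) g x.
Proof.
move=> dg; rewrite deriveE// {1}(row_sum_delta v) linear_sum; apply: eq_bigr => a _.
by rewrite linearZZ deriveE.
Qed.

End LocalForms.

Section Chart.
Variables (R : realType) (n : nat) (M : manifold R n) (w : bivector_family M)
  (e : frame_family M).
Variable c : chart M.
Local Notation V := 'rV[R]_n.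
Local Notation form := (seq V -> R^o).
Local Notation U := (chart_image c).
Hypothesis w_poisson : poisson_bivector w.
Hypothesis e_frame : local_frame e.
Implicit Types (F G : form_family M) (x v : V).

Lemma open_chart_image : open U. Proof. exact: chart_image_open. Qed.

Definition dbivector x v : 'M[R]_n := \matrix_(k, l) 'D_v (fun y => w c y k l : R^o) x.

Lemma bivector_anti x : U x -> (w c x)^T = - w c x.
Proof. by move=> Ux; have [[h _ _] _] := w_poisson; exact: h. Qed.

Lemma bivector_smooth : smooth_on U (w c).
Proof. by have [[_ h _] _] := w_poisson; exact: h. Qed.

Lemma frame_unit x : U x -> e c x \in unitmx.
Proof. by move=> Ux; have [_ h] := e_frame c; exact: h. Qed.

Lemma mx_is_diff_bivector x : U x -> mx_is_diff x (w c) (dbivector x).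
Proof.
move=> Ux k l; rewrite /dbivector; under [X in is_diff _ _ X]eq_fun do rewrite mxE.
apply: is_diff_derive; apply: (@smooth_differentiable _ _ U) => //.
by apply: smooth_entry; [exact: open_chart_image|exact: bivector_smooth].
Qed.

Lemma dbivector_anti x v : U x -> (dbivector x v)^T = - dbivector x v.
Proof.
move=> Ux; apply/matrixP => k l; rewrite !mxE.
have dl : derivable (fun y => w c y k l : R^o) x v.
  by apply: diff_derivable; have [] := mx_is_diff_bivector Ux k l.
rewrite -(deriveN dl); apply: (derive_eq_on open_chart_image) => // y Uy.
by have /matrixP/(_ k l) := bivector_anti Uy; rewrite !mxE.
Qed.

(** The vanishing of the Schouten bracket, halved; the sign between the index
conventions comes from the antisymmetry of w. *)
Lemma poisson_jacobi x (j := jacobiator (w c x) (fun a => dbivector x (bvec R a))) : U x ->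
  forall p q r, j p q r + j q r p + j r p q = 0.
Proof.
move=> Ux p q r; have [_ /(_ c x Ux p q r)] := w_poisson.
have E p' q' r' : \sum_(l < n) (w c x l p' * 'D_(delta_mx 0 l) (fun y => w c y q' r' : R^o) x +
     w c x l p' * 'D_(delta_mx 0 l) (fun y => w c y q' r' : R^o) x) = - (2 * j p' q' r').
  rewrite mulr_sumr -sumrN; apply: eq_bigr => l _.
  have /matrixP/(_ p' l) := bivector_anti Ux; rewrite !mxE => ->; rewrite /bvec; ring.
rewrite /schouten !E => h; lra.
Qed.

Lemma contract_wE F x : U x -> multilinear (F c x) -> contract_w w e F c x =
  contr_w (w c x) (F c x).
Proof.
move=> Ux Fl; rewrite /contract_w /contr_w /contr_bivector; congr (_ *: _).
rewrite /frame_comp.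
rewrite (@frame_sum R n form (fun u v => contract_first (contract_first (F c x) v) u)).
- by rewrite frame_compK//; exact: frame_unit.
- move=> v r u u'; apply/funext => s; exact: (Fl [:: v] s r u u').
- move=> u r v v'; apply/funext => s; exact: (Fl [::] (u :: s) r v v').
Qed.

(** Where the coefficients are differentiable, the directional derivative is
linear in the direction, so it can be expanded in the coordinate directions. *)
Lemma ext_dE F x f' : U x -> form_is_diff x (F c) f' ->
  ext_d F c x = \sum_a wedge_dx R a (f' (bvec R a)).
Proof.
move=> Ux hf; apply/funext => s; rewrite /ext_d mem_set// fct_sumE.
transitivity (\sum_(k < size s) \sum_a (-1) ^+
  k * (nth 0 s k 0 a * f' (bvec R a) (take k s ++ drop k.+1 s))).
  apply: eq_bigr => k _; rewrite derive_sum_coord.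
    rewrite mulr_sumr; apply: eq_bigr => a _.
    by rewrite -[X in _ * (_ * X)]/(jet (F c) x (bvec R a) _) (jet_form_is_diff _ hf).
  by have [] := hf (take k s ++ drop k.+1 s).
rewrite exchange_big; apply: eq_bigr => a _; apply: eq_bigr => k _.
by rewrite mulrA.
Qed.

Lemma ext_d_out F x : ~ U x -> ext_d F c x = 0.
Proof. by move=> Ux; apply/funext => s; rewrite /ext_d memNset. Qed.

Lemma form_is_diff_near x (f g : V -> form) f' : U x -> (forall y, U y -> f y = g y) ->
  form_is_diff x f f' -> form_is_diff x g f'.
Proof.
move=> Ux fg hf s; have [d1 d2] := hf s.
have fgs y : U y -> f y s = g y s by move=> /fg ->.
have near_fg : \forall y \near x, f y s = g y s.
  exact: filterS (open_nbhs_nbhs (conj open_chart_image Ux)).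
have dg : differentiable (fun y => g y s : R^o) x by exact: near_eq_differentiable near_fg d1.
apply: DiffDef; [exact: dg|rewrite -d2; apply/funext => v].
transitivity ('D_v (fun y => g y s : R^o) x); first by rewrite deriveE.
transitivity ('D_v (fun y => f y s : R^o) x); last by rewrite deriveE.
by apply/esym; exact: (derive_eq_on open_chart_image).
Qed.

(** The multilinearity of F in the whole chart is used to differentiate w |- F
in coordinates, where no derivative of the frame appears. *)
Lemma koszulE F x f' : U x -> (forall y, U y -> multilinear (F c y)) ->
  form_is_diff x (F c) f' -> (forall v, is_form (f' v)) ->
  koszul w e F c x = koszul_bv (w c x) (fun a => dbivector x (bvec R a)) (F c x)
    (fun a => f' (bvec R a)).
Proof.
move=> Ux Fl hf ff'.
have iwf : form_is_diff x (contract_w w e F c)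
  (fun v => contr_w (dbivector x v) (F c x) + contr_w (w c x) (f' v)).
  apply: (form_is_diff_near Ux (f := fun y => contr_w (w c y) (F c y))).
    by move=> y Uy; rewrite contract_wE//; exact: Fl.
  by apply: form_is_diff_contr_w => //; exact: mx_is_diff_bivector.
rewrite /koszul.
rewrite -[LHS]/(contract_w w e (ext_d F) c x - ext_d (contract_w w e F) c x).
rewrite (ext_dE Ux iwf) contract_wE//; last first.
  rewrite (ext_dE Ux hf); apply: (proj1 (_ : is_form _)); apply: is_form_sum => a _.
  exact: is_form_wedge_dx.
rewrite (ext_dE Ux hf) /koszul_bv /koszul_jet.
rewrite -[LHS]/((contr_w (w c x)) (\sum_a wedge_dx R a (f' (bvec R a))) -
  \sum_a wedge_dx R a (contr_w (dbivector x (bvec R a)) (F c x) +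
    contr_w (w c x) (f' (bvec R a)))).
rewrite /contr_w (linear_sum (contr_bivector _ _)) -sumrB -sumrN; apply: eq_bigr => a _.
rewrite /= (@contr_bivector_wedge R n form (@contr_bv R n) (@wedge_dx R n)
  (@contr_bv_wedge_dx R n)); last exact: bivector_anti.
rewrite (linearD (wedge_dx R a)) [X in _ - X]addrC opprD addrACA subrr add0r -opprD.
by [].
Qed.

Lemma is_form_koszul_bv x (f : form) (df : 'I_n -> form) :
  is_form f -> (forall a, is_form (df a)) ->
  is_form (koszul_bv (w c x) (fun a => dbivector x (bvec R a)) f df).
Proof.
move=> ff fdf; apply/is_formN/is_form_sum => a _; apply: is_formD.
  by apply: is_form_sum => k _; apply/is_formZ/is_form_contr.
exact: (is_form_wedge_dx a (is_form_contr_w (dbivector x (bvec R a)) ff)).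
Qed.

Lemma qtermE m F G x : U x -> is_form (F c x) -> is_form (G c x) ->
  qterm w e m F G c x = shuffle (qpower (w c x) m (tensor (F c x) (G c x))).
Proof.
move=> Ux fF fG; rewrite -(qterm_shuffle m (w c x) (frame_unit Ux) fF fG).
by [].
Qed.

Section Leibniz.
Variables F G : form_family M.
Hypotheses (regF : regular U (F c)) (regG : regular U (G c)).

Lemma form_is_diff_qterm m x : U x ->
  form_is_diff x (qterm w e m F G c) (fun v => shuffle (qpower (w c x) m
      (tensor (jet (F c) x v) (G c x) + tensor (F c x) (jet (G c) x v)) +
    m%:R *: qpairing (dbivector x v) (qpower (w c x) m.-1 (tensor (F c x) (G c x))))).
Proof.
move=> Ux.
apply: (form_is_diff_near Ux (f := fun y => shuffle (qpower (w c y) m (tensor (F c y) (G c y))))).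
  by move=> y Uy; rewrite qtermE//; [exact: regF.1|exact: regG.1].
apply: form_is_diff_shuffle; apply: biform_is_diff_power.
- exact: mx_is_diff_bivector.
- by apply: biform_is_diff_tensor; apply: (form_is_diff_jet (U := U)).
- by apply: is_biform_tensor; [exact: regF.1|exact: regG.1].
Qed.

Lemma is_form_qterm m x : U x -> is_form (qterm w e m F G c x).
Proof.
move=> Ux; rewrite qtermE//; [|exact: regF.1|exact: regG.1].
by apply: is_form_shuffle; apply: is_biform_qpower; apply: is_biform_tensor;
  [exact: regF.1|exact: regG.1].
Qed.

Lemma regular_qterm m : regular U (qterm w e m F G c).
Proof.
split=> [x Ux|s x Ux]; first exact: is_form_qterm.
by have [] := form_is_diff_qterm m Ux s.
Qed.

Lemma ext_d_form x : U x -> is_form (ext_d F c x).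
Proof.
move=> Ux; rewrite (ext_dE Ux (form_is_diff_jet regF Ux)).
by apply: is_form_sum => a _; apply/is_form_wedge_dx/(is_form_jet open_chart_image).
Qed.

Lemma koszul_jet_form x : U x ->
  koszul w e F c x = koszul_bv (w c x) (fun a => dbivector x (bvec R a)) (F c x)
    (fun a => jet (F c) x (bvec R a)).
Proof.
move=> Ux; apply: koszulE => //; [|exact: (form_is_diff_jet regF)|].
  by move=> y Uy; have [] := regF.1 y Uy.
by move=> v; exact: (is_form_jet open_chart_image).
Qed.

Lemma koszul_form x : U x -> is_form (koszul w e F c x).
Proof.
move=> Ux; rewrite koszul_jet_form//; apply: is_form_koszul_bv; first exact: regF.1.
by move=> a; exact: (is_form_jet open_chart_image).
Qed.

End Leibniz.

End Chart.

(** * The Leibniz rule at each order in h *)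

Section TensorRules.
Variables (R : realType) (n : nat).
Local Notation V := 'rV[R]_n.
Local Notation form := (seq V -> R^o).
Local Notation biform := (seq V -> seq V -> R^o).
Implicit Types (f g : form) (W : 'M[R]_n) (a k : 'I_n).

Definition tensorl g f : biform := tensor f g.
Definition tensorr f g : biform := tensor f g.
Fact tensorl_linear g : linear (tensorl g).
Proof.
move=> r f f'; apply/funext => s; apply/funext => t.
change ((r * f s + f' s) * g t = r * (f s * g t) + f' s * g t); ring.
Qed.
HB.instance Definition _ g := GRing.isLinear.Build R form biform _ (tensorl g) (tensorl_linear g).
Fact tensorr_linear f : linear (tensorr f).
Proof.
move=> r g g'; apply/funext => s; apply/funext => t.
change (f s * (r * g t + g' t) = r * (f s * g t) + f s * g' t); ring.
Qed.
HB.instance Definition _ f := GRing.isLinear.Build R form biform _ (tensorr f) (tensorr_linear f).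

Definition stensorr f g : biform := sign1 (tensorr f g).
Fact stensorr_linear f : linear (stensorr f).
Proof. by move=> r g g'; rewrite /stensorr (tensorr_linear f) (sign1_linear r). Qed.
HB.instance Definition _ f := GRing.isLinear.Build R form biform _ (stensorr f)
  (stensorr_linear f).

Lemma tensorl_wedge_dx a f g : tensorl g (wedge_dx R a f) = wedge_l R a (tensorl g f).
Proof.
apply/funext => s; apply/funext => t.
change (cowedge (dual_coord a) f s * g t = cowedge (dual_coord a) (fun s => f s * g t) s).
rewrite /cowedge mulr_suml; apply: eq_bigr => k _; exact/esym/mulrA.
Qed.

Lemma stensorr_wedge_dx a f g : stensorr f (wedge_dx R a g) = wedge_r R a (tensorr f g).
Proof.
rewrite /stensorr wedge_rE; congr sign1.
apply/funext => s; apply/funext => t.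
change (f s * cowedge (dual_coord a) g t = cowedge (dual_coord a) (fun t => f s * g t) t).
rewrite /cowedge mulr_sumr; apply: eq_bigr => k _; exact: mulrCA.
Qed.

Lemma tensorl_sum_wedge_dx g (f : 'I_n -> form) :
  tensorl g (\sum_a wedge_dx R a (f a)) = \sum_a wedge_l R a (tensorl g (f a)).
Proof. by rewrite (linear_sum (tensorl g)); apply: eq_bigr => a _; exact: tensorl_wedge_dx. Qed.

Lemma stensorr_sum_wedge_dx f (g : 'I_n -> form) :
  stensorr f (\sum_a wedge_dx R a (g a)) = \sum_a wedge_r R a (tensorr f (g a)).
Proof. by rewrite (linear_sum (stensorr f)); apply: eq_bigr => a _; exact: stensorr_wedge_dx. Qed.

Lemma tensorl_contr_row W a f g :
  tensorl g (contr_row (@contr_bv R n) W a f) = contr_row (@contr_l R n) W a (tensorl g f).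
Proof.
rewrite /contr_row (linear_sum (tensorl g)); apply: eq_bigr => k _.
by rewrite (linearZZ (tensorl g)).
Qed.

Lemma tensorl_contr_bivector W f g : tensorl g (contr_bivector (@contr_bv R n) W f) =
  contr_bivector (@contr_l R n) W (tensorl g f).
Proof. by rewrite /contr_bivector (linearZZ (tensorl g)) (linear_comb2 (tensorl g)). Qed.

Lemma stensorr_contr_row W a f g :
  stensorr f (contr_row (@contr_bv R n) W a g) = contr_row (@contr_r R n) W a (tensorr f g).
Proof.
rewrite /contr_row (linear_sum (stensorr f)); apply: eq_bigr => k _.
by rewrite (linearZZ (stensorr f)).
Qed.

Lemma tensorr_contr_bivector W f g : tensorr f (contr_bivector (@contr_bv R n) W g) =
  contr_bivector (@contr_r R n) W (tensorr f g).
Proof.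
rewrite /contr_bivector (linearZZ (tensorr f)) (linear_comb2 (tensorr f)); congr (_ *: _).
by apply: eq_sum2 => k l; rewrite !contr_rE contr2_sign1 sign1K.
Qed.

Lemma tensorl_koszul_bv W (dW : 'I_n -> 'M[R]_n) f (df : 'I_n -> form) g :
  tensorl g (koszul_bv W dW f df) =
  koszul_jet (@contr_l R n) (@wedge_l R n) W dW (tensorl g f) (fun a => tensorl g (df a)).
Proof.
rewrite /koszul_bv /koszul_jet (linearN (tensorl g)) (linear_sum (tensorl g)).
congr (- _); apply: eq_bigr => a _.
by rewrite (linearD (tensorl g)) /= tensorl_contr_row tensorl_wedge_dx tensorl_contr_bivector.
Qed.

Lemma stensorr_koszul_bv W (dW : 'I_n -> 'M[R]_n) f g (dg : 'I_n -> form) :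
  stensorr f (koszul_bv W dW g dg) =
  koszul_jet (@contr_r R n) (@wedge_r R n) W dW (tensorr f g) (fun a => tensorr f (dg a)).
Proof.
rewrite /koszul_bv /koszul_jet (linearN (stensorr f)) (linear_sum (stensorr f)).
congr (- _); apply: eq_bigr => a _.
by rewrite (linearD (stensorr f)) /= stensorr_contr_row stensorr_wedge_dx tensorr_contr_bivector.
Qed.

End TensorRules.

Section ChartLeibniz.
Variables (R : realType) (n : nat) (M : manifold R n) (w : bivector_family M)
  (e : frame_family M).
Variable c : chart M.
Local Notation V := 'rV[R]_n.
Local Notation form := (seq V -> R^o).
Local Notation U := (chart_image c).
Hypothesis w_poisson : poisson_bivector w.
Hypothesis e_frame : local_frame e.
Variables F G : form_family M.
Hypotheses (regF : regular U (F c)) (regG : regular U (G c)).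

(** The sign of alpha enters as the scalar r, on which the sign operator of the
left factor acts; a form of even or odd degree satisfies the hypothesis with
r = 1 or r = -1. *)
Lemma leibniz_order m (r : R) x : U x ->
  (forall s, (-1) ^+ size s * F c x s = r * F c x s) ->
  (ext_d (qterm w e m F G) c x : form) - m%:R *: (koszul w e (qterm w e m.-1 F G) c x : form) =
  (qterm w e m (ext_d F) G c x : form) + r *: (qterm w e m F (ext_d G) c x : form) -
  m%:R *: ((qterm w e m.-1 (koszul w e F) G c x : form) +
           r *: (qterm w e m.-1 F (koszul w e G) c x : form)).
Proof.
move=> Ux Fr.
have fF := regF.1 x Ux; have fG := regG.1 x Ux.
have UO := @open_chart_image R n M c.
pose W := w c x; pose dW a := dbivector w c x (bvec R a).
pose A a := tensor (jet (F c) x (bvec R a)) (G c x).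
pose B a := tensor (F c x) (jet (G c) x (bvec R a)).
pose T := tensor (F c x) (G c x).
have okT : is_biform T by exact: is_biform_tensor.
have okA a : is_biform (A a) by apply: is_biform_tensor => //; exact: (is_form_jet UO).
have okB a : is_biform (B a) by apply: is_biform_tensor => //; exact: (is_form_jet UO).
have rsgn (f : form) : r *: tensor (F c x) f = sign1 (tensor (F c x) f).
  apply/funext => s; apply/funext => t.
  change (r * (F c x s * f t) = (-1) ^+ size s * (F c x s * f t)).
  by rewrite !mulrA Fr.
have rmu p (f : form) : r *: shuffle (qpower W p (tensor (F c x) f)) =
  shuffle (qpower W p (sign1 (tensor (F c x) f))).
  rewrite -rsgn.
  exact/esym/(linearZZ (@shuffle_lin R n \o @power R n _ (@contr_l R n) (@contr_r R n) W p)).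
have L := @deformed_leibniz R n _ _ (@contr_l R n) (@contr_r R n) (@wedge_l R n) (@wedge_r R n)
  (@shuffle_lin R n)
  (@contr_bv R n) (@wedge_dx R n) (@is_biform R V) (is_biform0 V) (@is_biformD R V)
    (@is_biformZ R V)
  (@is_biform_contr_l R n) (@is_biform_contr_r R n) (@contr_lC R n) (@contr_rC R n)
    (@contr_lrC R n) (@contr_l_wedge_l R n) (@contr_r_wedge_r R n)
  (@contr_l_wedge_r R n) (@contr_r_wedge_l R n) (@contr_bv_shuffle R n) (@shuffle_wedge_l R n)
    (@shuffle_wedge_r R n) W dW (bivector_anti w_poisson Ux)
  (fun a => dbivector_anti w_poisson _ Ux) (poisson_jacobi w_poisson Ux) m T A B okT okA okB.
have okQ p : forall y, U y -> multilinear (qterm w e p F G c y).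
  by move=> y Uy; have [] := @is_form_qterm _ _ _ w e c e_frame F G regF regG p y Uy.
have fQ p := @form_is_diff_qterm _ _ _ w e c w_poisson e_frame F G regF regG p x Ux.
rewrite (ext_dE Ux (fQ m)) (koszulE w_poisson e_frame Ux (okQ m.-1) (fQ m.-1)); last first.
  move=> v; rewrite -(jet_form_is_diff v (fQ m.-1)); apply: (is_form_jet UO) => //.
  exact: regular_qterm.
have dF := ext_d_form regF Ux; have dG := ext_d_form regG Ux.
have kF := koszul_form w_poisson e_frame regF Ux.
have kG := koszul_form w_poisson e_frame regG Ux.
rewrite !(qtermE w e_frame _ Ux) //.
rewrite !rmu.
have -> : tensor (ext_d F c x) (G c x) = \sum_a wedge_l R a (A a).
  by rewrite (ext_dE Ux (form_is_diff_jet regF Ux)); exact: tensorl_sum_wedge_dx.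
have -> : sign1 (tensor (F c x) (ext_d G c x)) = \sum_a wedge_r R a (B a).
  by rewrite (ext_dE Ux (form_is_diff_jet regG Ux)); exact: stensorr_sum_wedge_dx.
have -> : tensor (koszul w e F c x) (G c x) = koszul_jet (@contr_l R n) (@wedge_l R n) W dW T A.
  by rewrite (koszul_jet_form w_poisson e_frame regF Ux); exact: tensorl_koszul_bv.
have -> : sign1 (tensor (F c x) (koszul w e G c x)) =
  koszul_jet (@contr_r R n) (@wedge_r R n) W dW T B.
  by rewrite (koszul_jet_form w_poisson e_frame regG Ux); exact: stensorr_koszul_bv.
exact: L.
Qed.

End ChartLeibniz.

(** * The square of the deformed differential *)

(** Model: d is the exterior derivative, i the operator w |-, and k, their
commutator, the codifferential; S is the set of smooth forms. *)
Section CommutatorSquare.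
Variables (R : realFieldType) (L : lmodType R) (S : L -> Prop) (d i : L -> L).
Hypothesis SB : forall f g, S f -> S g -> S (f - g).
Hypothesis Sd : forall f, S f -> S (d f).
Hypothesis Si : forall f, S f -> S (i f).
Hypothesis dB : forall f g, S f -> S g -> d (f - g) = d f - d g.
Hypothesis iB : forall f g, i (f - g) = i f - i g.
Hypothesis dd : forall f, S f -> d (d f) = 0.
Let k f := i (d f) - d (i f).
Hypothesis ik : forall f, S f -> i (k f) = k (i f).

Let i0 : i 0 = 0. Proof. by rewrite -[X in i X](subrr 0) iB subrr. Qed.
Lemma S_commutator f : S f -> S (k f).
Proof. by move=> Sf; apply: SB; [exact/Si/Sd|exact/Sd/Si]. Qed.

Lemma d_commutator f : S f -> d (k f) = d (i (d f)).
Proof.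
by move=> Sf; rewrite dB ?dd ?subr0//; [exact: Si|exact/Si/Sd|exact/Sd/Si].
Qed.

Lemma commutator_d f : S f -> k (d f) = - d (i (d f)).
Proof. by move=> Sf; rewrite /k dd// i0 sub0r. Qed.

Lemma commutatorB f g : S f -> S g -> k (f - g) = k f - k g.
Proof.
move=> Sf Sg; rewrite /k dB// !iB dB; [|exact: Si..].
by rewrite !opprD !opprK addrACA.
Qed.

(** Commuting i past k on d f, and on f followed by d, shows that i d i d f and
d i d i f are both half of d i i d f; their difference is k (k f). *)
Lemma commutator_commutator f : S f -> k (k f) = 0.
Proof.
move=> Sf; have Sif := Si Sf; have Sdf := Sd Sf.
have E1 : i (d (i (d f))) + i (d (i (d f))) = d (i (i (d f))).
  have := ik Sdf; rewrite commutator_d// /k -[X in i X]sub0r iB i0 sub0r.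
  set A := i (d (i (d f))); set B := d (i (i (d f))) => h.
  by rewrite -{1}[A]opprK h opprB subrK.
have E2 : d (i (d (i f))) + d (i (d (i f))) = d (i (i (d f))).
  have := congr1 d (ik Sf); rewrite /k iB !dB; try by [do 6?[exact: Sf|apply: Si|apply: Sd]].
  rewrite (dd (Si Sif)) subr0 => /eqP; rewrite subr_eq => /eqP ->.
  by [].
have kk : k (k f) = i (d (i (d f))) - d (i (d (i f))).
  rewrite {1}/k d_commutator// ik// [k (i f)]/k dB ?dd ?subr0//.
  - exact: Si.
  - exact/Si/Sd.
  - exact/Sd/Si.
by rewrite kk [LHS]scale_half_double addrACA E1 -opprD E2 subrr scaler0.
Qed.

Lemma deformed_differential_sqr f g h : S f -> S g -> S h ->
  d (d f - k g) - (i (d (d g - k h)) - d (i (d g - k h))) = 0.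
Proof.
move=> Sf Sg Sh; rewrite -[i _ - _]/(k _) commutatorB; [|exact: Sd|exact: S_commutator].
rewrite dB ?dd// ?sub0r; [|exact: Sd|exact: S_commutator].
by rewrite commutator_commutator// subr0 d_commutator// commutator_d// opprK addNr.
Qed.

End CommutatorSquare.

Section SmoothForms.
Variables (R : realType) (n : nat) (M : manifold R n) (w : bivector_family M)
  (e : frame_family M).
Variable c : chart M.
Local Notation V := 'rV[R]_n.
Local Notation form := (seq V -> R^o).
Local Notation L := (V -> form).
Local Notation U := (chart_image c).
Hypothesis w_poisson : poisson_bivector w.
Hypothesis e_frame : local_frame e.
Implicit Types (f g : L) (x v : V).

(** The vanishing outside of the chart makes the operators below act on
functions, so that the algebra of the previous section applies to equalities
and not only to equalities on U. *)
Definition smooth_form f := [/\ forall x, U x -> is_form (f x),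
  forall s, smooth_on U (fun x => f x s : R^o) & forall x, ~ U x -> f x = 0].

Definition ext_d_loc f : L := @ext_d R n M (fun _ => f) c.
Definition contract_loc f : L := @contract_w R n M w e (fun _ => f) c.

Let UO := @open_chart_image R n M c.

Lemma smooth_form_regular f : smooth_form f -> regular U f.
Proof.
by move=> [h1 h2 _]; split=> // s x Ux; exact: (smooth_differentiable (h2 s)).
Qed.

Lemma smooth_formB f g : smooth_form f -> smooth_form g -> smooth_form (f - g).
Proof.
move=> [f1 f2 f3] [g1 g2 g3]; split.
- by move=> x Ux; apply: is_formD; [exact: f1|exact/is_formN/g1].
- move=> s; rewrite (_ : (fun x => _) = (fun x => f x s : R^o) +
  (-1 : R) *: (fun x => g x s : R^o)).
    by apply: (smoothD UO) => //; exact: (smoothZ UO).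
  by apply/funext => x; rewrite -[RHS]/(f x s + -1 * g x s) mulN1r.
- by move=> x Ux; rewrite -[LHS]/(f x - g x) f3// g3// subrr.
Qed.

Lemma smooth_form_ext_d_loc f : smooth_form f -> smooth_form (ext_d_loc f).
Proof.
move=> Sf; have [f1 f2 f3] := Sf; split.
- move=> x Ux; exact: (@ext_d_form R n M c (fun=> f) (smooth_form_regular Sf) x Ux).
- move=> s; apply: (eq_smooth UO (f := \sum_(k < size s) ((-1) ^+ k : R) *:
      'D_(nth 0 s k) (fun y => f y (take k s ++ drop k.+1 s) : R^o))).
    move=> x Ux; rewrite /ext_d_loc /ext_d mem_set// fct_sumE; apply: eq_bigr => k _.
    by [].
  by apply: (smooth_sum UO) => k _; apply: (smoothZ UO); exact: smooth_derive.
- by move=> x Ux; exact: ext_d_out.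
Qed.

Lemma contract_loc_out f x : f x = 0 -> contract_loc f x = 0.
Proof.
move=> fx; rewrite /contract_loc /contract_w fx; rewrite big1 ?scaler0// => k _.
by rewrite big1// => l _; exact: scaler0.
Qed.

Lemma contract_locE f x : U x -> is_form (f x) -> contract_loc f x = contr_w (w c x) (f x).
Proof. by move=> Ux [fl _]; exact: (@contract_wE _ _ _ w e c e_frame (fun=> f)). Qed.

Lemma smooth_form_contract_loc f : smooth_form f -> smooth_form (contract_loc f).
Proof.
move=> [f1 f2 f3]; split.
- by move=> x Ux; rewrite contract_locE; [apply: is_form_contr_w; exact: f1| |exact: f1].
- move=> s; apply: (eq_smooth UO (f := (2^-1 : R) *: \sum_(k < n) \sum_(l < n)
      ((fun x => w c x k l : R^o) * (fun x => f x (bvec R l :: bvec R k :: s) : R^o)))).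
    move=> x Ux; rewrite contract_locE//; last exact: f1.
    rewrite /contr_w /contr_bivector.
    change (2^-1 * (\sum_(k < n) \sum_(l < n)
      ((fun x => w c x k l : R^o) * (fun x => f x (bvec R l :: bvec R k :: s) : R^o))) x =
      2^-1 * (\sum_(k < n) \sum_(l < n) w c x k l *: contr_bv R k (contr_bv R l (f x))) s).
    rewrite !fct_sumE; congr (_ * _); apply: eq_bigr => k _.
    by rewrite !fct_sumE.
  apply: (smoothZ UO); apply: (smooth_sum UO) => k _; apply: (smooth_sum UO) => l _.
  apply: (smoothM UO) => //; apply: (smooth_entry UO); exact: bivector_smooth.
- by move=> x Ux; apply: contract_loc_out; exact: f3.
Qed.

Lemma contract_locB f g : contract_loc (f - g) = contract_loc f - contract_loc g.
Proof.
apply/funext => x; rewrite -[RHS]/(contract_loc f x - contract_loc g x) /contract_loc /contract_w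
  -scalerBr; congr (_ *: _).
rewrite -sumrB; apply: eq_bigr => k _; rewrite -sumrB; apply: eq_bigr => l _.
by rewrite -scalerBr.
Qed.

Lemma ext_d_locE f x : regular U f -> U x -> ext_d_loc f x =
  \sum_a wedge_dx R a (jet f x (bvec R a)).
Proof. by move=> rf Ux; exact: (@ext_dE _ _ _ c (fun=> f) x _ Ux (form_is_diff_jet rf Ux)). Qed.

Lemma ext_d_locB f g : smooth_form f -> smooth_form g -> ext_d_loc (f - g) = ext_d_loc f -
  ext_d_loc g.
Proof.
move=> Sf Sg; apply/funext => x.
have [Ux|Ux] := pselect (U x); last first.
  by rewrite -[RHS]/(ext_d_loc f x - ext_d_loc g x) /ext_d_loc !ext_d_out// subr0.
rewrite -[RHS]/(ext_d_loc f x - ext_d_loc g x).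
have rf := smooth_form_regular Sf; have rg := smooth_form_regular Sg.
rewrite (ext_d_locE rf Ux) (ext_d_locE rg Ux)
  (ext_d_locE (smooth_form_regular (smooth_formB Sf Sg)) Ux).
rewrite -sumrB; apply: eq_bigr => a _; rewrite -linearB; congr (wedge_dx R a _).
apply: (@jet_form_is_diff _ _ _ _ (fun v => jet f x v - jet g x v)).
by move=> s; have h := is_diffB (form_is_diff_jet rf Ux s) (form_is_diff_jet rg Ux s).
Qed.

Lemma cowedgeC (l l' : V -> R) (f : form) : cowedge l (cowedge l' f) = - cowedge l' (cowedge l f).
Proof.
apply/funext => s; rewrite -[RHS]/(- cowedge l' (cowedge l f) s).
elim: s f => [|v s IH] f; first by rewrite /cowedge !big_ord0 oppr0.
rewrite !cowedge_cons !contr_cowedge (linearB (cowedge l)) (linearB (cowedge l'))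
  (linearZZ (cowedge l)) (linearZZ (cowedge l')) /=.
change (l v * cowedge l' f s - (l' v * cowedge l f s - cowedge l (cowedge l' (contr v f)) s) =
  - (l' v * cowedge l f s - (l v * cowedge l' f s - cowedge l' (cowedge l (contr v f)) s))).
rewrite IH; ring.
Qed.

(** The second derivatives are symmetric in the two directions, whereas covector
multiplications anticommute. *)
Lemma ext_d_loc_sqr f : smooth_form f -> ext_d_loc (ext_d_loc f) = 0.
Proof.
move=> Sf; have Sdf := smooth_form_ext_d_loc Sf; have [f1 f2 f3] := Sf.
have rf := smooth_form_regular Sf; have rdf := smooth_form_regular Sdf.
apply/funext => x; have [Ux|Ux] := pselect (U x); last by rewrite /ext_d_loc ext_d_out.
rewrite ext_d_locE//.
pose H a b : form := fun s => 'D_(bvec R a) ('D_(bvec R b) (fun y => f y s : R^o)) x.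
have jE a : jet (ext_d_loc f) x (bvec R a) = \sum_b wedge_dx R b (H a b).
  pose J v := \sum_b wedge_dx R b (fun s => 'D_v ('D_(bvec R b) (fun y => f y s : R^o)) x).
  rewrite -[RHS]/(J (bvec R a)); apply: jet_form_is_diff.
  apply: (form_is_diff_near Ux (f := fun y => \sum_b wedge_dx R b (jet f y (bvec R b)))).
    by move=> y Uy; rewrite ext_d_locE.
  apply: form_is_diff_sum => b s; apply: is_diff_bigsum => k.
  apply: is_diffZ; apply: is_diff_derive; apply: (smooth_differentiable (U := U)) => //.
  exact: smooth_derive.
have HC a b : H a b = H b a.
  apply/funext => s; apply: derive_comm.
  - apply: filterS (open_nbhs_nbhs (conj UO Ux)) => y Uy.
    exact: (smooth_differentiable (f2 s)).
  - by apply: (smooth_differentiable (U := U)) => //; exact: smooth_derive.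
  - by apply: (smooth_differentiable (U := U)) => //; exact: smooth_derive.
under eq_bigr do rewrite jE linear_sum.
rewrite [LHS]scale_half_double {2}exchange_big -big_split big1 ?scaler0// => a _.
rewrite -big_split big1// => b _ /=.
have -> : wedge_dx R b (wedge_dx R a (H b a)) = -
  wedge_dx R a (wedge_dx R b (H b a)) by exact: cowedgeC.
by rewrite HC addrN.
Qed.

(** The pointwise identity [contr_bivector_koszul], applied to the jet of f. *)
Lemma contract_loc_commutator f (k := fun f => contract_loc (ext_d_loc f) -
  ext_d_loc (contract_loc f)) : smooth_form f ->
  contract_loc (k f) = k (contract_loc f).
Proof.
move=> Sf; have rf := smooth_form_regular Sf.
apply/funext => x; have [Ux|Ux] := pselect (U x); last first.
  have z g : g x = 0 -> k g x = 0.
    move=> gx; rewrite -[LHS]/(contract_loc (ext_d_loc g) x - ext_d_loc (contract_loc g) x)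
      contract_loc_out /ext_d_loc ?ext_d_out// subrr.
    by [].
  have fx : f x = 0 by have [_ _ ->] := Sf.
  by rewrite (z (contract_loc f) (contract_loc_out fx)); apply: contract_loc_out; exact: z.
have ff : is_form (f x) by have [h _ _] := Sf; exact: h.
have kf : k f x = koszul_bv (w c x) (fun a => dbivector w c x (bvec R a)) (f x)
  (fun a => jet f x (bvec R a)).
  exact: (@koszul_jet_form _ _ _ w e c w_poisson e_frame (fun=> f) rf x Ux).
have fkf : is_form (k f x) by exact:
  (@koszul_form _ _ _ w e c w_poisson e_frame (fun=> f) rf x Ux).
rewrite contract_locE// kf /contr_w /koszul_bv.
have Sif := smooth_form_contract_loc Sf.
have jE v : jet (contract_loc f) x v = contr_w (dbivector w c x v) (f x) +
  contr_w (w c x) (jet f x v).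
  apply: (@jet_form_is_diff _ _ _ _ (fun v => contr_w (dbivector w c x v) (f x) +
    contr_w (w c x) (jet f x v))).
  apply: (form_is_diff_near Ux (f := fun y => contr_w (w c y) (f y))).
    by move=> y Uy; rewrite contract_locE//; exact: rf.1.
  by apply: form_is_diff_contr_w; [exact: mx_is_diff_bivector|exact: form_is_diff_jet rf Ux].
have -> : k (contract_loc f) x = koszul_bv (w c x) (fun a => dbivector w c x (bvec R a))
  (contract_loc f x) (fun a => jet (contract_loc f) x (bvec R a)).
  exact: (@koszul_jet_form _ _ _ w e c w_poisson e_frame (fun=> contract_loc f)
    (smooth_form_regular Sif) x Ux).
rewrite contract_locE//.
have -> : (fun a => jet (contract_loc f) x (bvec R a)) =
    (fun a => contr_w (w c x) (jet f x (bvec R a)) + contr_w (dbivector w c x (bvec R a)) (f x)).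
  by apply/funext => a; rewrite jE addrC.
apply: (@contr_bivector_koszul R n form (@contr_bv R n) (@wedge_dx R n) (@is_form R V)).
- by move=> l z; exact: is_form_contr.
- exact: contr_bvC.
- exact: contr_bv_wedge_dx.
- exact: bivector_anti.
- by move=> a; exact: dbivector_anti.
- exact: poisson_jacobi.
- exact: ff.
- by move=> a; exact: (is_form_jet UO).
Qed.

End SmoothForms.

(** * Laurent polynomials in h *)

Lemma widen_fset_sum (T : choiceType) (Z : nmodType) (A B : {fset T}) (p : T -> Z) :
  (forall a, a \notin A -> p a = 0) -> (forall a, a \notin B -> p a = 0) ->
  \sum_(a <- A) p a = \sum_(a <- B) p a.
Proof. by move=> pA pB; rewrite -(fsbigTE A p pA) -(fsbigTE B p pB). Qed.

(** The support of d_h alpha is contained in this set if that of alpha is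
contained in A, because delta raises the power of h by one. *)
Definition succ_fset (A : {fset int}) : {fset int} :=
  (A `|` [fset (a + 1)%R | a in A])%fset.

Lemma notin_succ_fset (A : {fset int}) a : a \notin succ_fset A ->
  a \notin A /\ (a - 1)%R \notin A.
Proof.
rewrite /succ_fset in_fsetU negb_or => /andP[-> h]; split=> //.
by apply: contra h => h; apply/imfsetP; exists (a - 1)%R => //=; rewrite subrK.
Qed.

Lemma shift_fset_sum (Z : nmodType) (A : {fset int}) (p : int -> Z) :
  (forall a, a \notin A -> p a = 0) ->
  \sum_(a <- succ_fset A) p (a - 1) = \sum_(a <- A) p a.
Proof.
move=> pA.
rewrite (@widen_fset_sum _ _ _ [fset (a + 1)%R | a in A]%fset (fun a => p (a - 1))).
- rewrite big_imfset /=; last by move=> a b _ _ /addIr.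
  by apply: eq_bigr => a _; rewrite addrK.
- by move=> a /notin_succ_fset[_ h]; exact: pA.
- move=> a h; apply: pA; apply: contra h => h; apply/imfsetP; exists (a - 1)%R => //=.
  by rewrite subrK.
Qed.

Lemma regroup_leibniz (R : comPzRingType) (Z : lmodType R) (q r N : R) (a b a' b' : Z) :
  q *: (a + r *: b - N *: (a' + r *: b')) =
  q *: (a - N *: a') + r *: (q *: (b - N *: b')).
Proof.
rewrite [r *: (q *: _)]scalerA [r * q]mulrC -scalerA -scalerDr; congr (_ *: _).
by rewrite scalerBr scalerDr opprD addrACA !scalerA [r * N]mulrC.
Qed.

Section QuantumProduct.
Variables (R : realType) (n : nat) (M : manifold R n) (w : bivector_family M)
  (e : frame_family M).
Local Notation V := 'rV[R]_n.
Local Notation form := (seq V -> R^o).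
Implicit Types (F G : form_family M) (z : int).

(** The coefficient of h^z in the quantum product of two forms. Giving it the
value 0 for negative z makes the Leibniz rule uniform in z. *)
Definition qcoef z F G : form_family M :=
  if z is Posz m then fun c x s => (m`!%:R)^-1 * qterm w e m F G c x s else 0.

Lemma qterm_eq0 m F G c x : F c x = 0 \/ G c x = 0 -> qterm w e m F G c x = 0.
Proof.
have last0 (l : seq V) : foldl (@contract_last R V) 0 l = 0 by elim: l.
have first0 (l : seq V) : foldl (@contract_first R V) 0 l = 0 by elim: l.
move=> h; rewrite /qterm big1// => I _; rewrite big1// => J _.
rewrite [X in _ *: X](_ : _ = (0 : form)) ?scaler0//; apply/funext => s.
rewrite /ext_prod big1// => p _.
by case: h => ->; rewrite ?last0 ?first0 -[(0 : form) _]/(0 : R) ?mulr0 ?mul0r.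
Qed.

Lemma qcoef_eq0 z F G c x : F c x = 0 \/ G c x = 0 -> qcoef z F G c x = 0.
Proof.
case: z => // m h; apply/funext => s; rewrite /qcoef qterm_eq0//.
exact: mulr0.
Qed.

Lemma inner_sum_qcoef (k a b : int) F G :
  \sum_(m \in [set m : nat | a + b + m%:Z = k])
    (fun c x s => (m`!%:R)^-1 * qterm w e m F G c x s : R) = qcoef (k - a - b) F G.
Proof.
case E : (k - a - b) => [m|m] /=.
  rewrite (_ : [set _ | _] = [set m]) ?fsbig_set1//.
  apply/seteqP; split=> p /=; last by move=> ->; rewrite -E; ring.
  by move=> h; apply/eqP; rewrite -eqz_nat -E -h; apply/eqP; ring.
rewrite (_ : [set _ | _] = set0) ?fsbig_set0//.
apply/seteqP; split=> p //= h.
have : p%:Z = Negz m by rewrite -E -h; ring.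
by [].
Qed.

Lemma qwedgeE (alpha beta : hform M) (A B : {fset int}) k :
  (forall a, a \notin A -> alpha a = 0) -> (forall b, b \notin B -> beta b = 0) ->
  qwedge w e alpha beta k = \sum_(a <- A) \sum_(b <- B) qcoef (k - a - b) (alpha a) (beta b).
Proof.
move=> hA hB; rewrite /qwedge.
rewrite (fsbigTE A); last first.
  move=> a /hA ->; rewrite fsbig1// => b _; rewrite inner_sum_qcoef.
  by apply/funext => c; apply/funext => x; apply: qcoef_eq0; left.
apply: eq_bigr => a _; rewrite (fsbigTE B); last first.
  move=> b /hB ->; rewrite inner_sum_qcoef.
  by apply/funext => c; apply/funext => x; apply: qcoef_eq0; right.
by apply: eq_bigr => b _; exact: inner_sum_qcoef.
Qed.

Lemma family_sumE (I : Type) (r : seq I) (F : I -> form_family M) c x :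
  (\sum_(i <- r) F i) c x = \sum_(i <- r) (F i c x : form).
Proof. by elim: r => [|i r IH]; rewrite ?big_nil// !big_cons -IH. Qed.

End QuantumProduct.

Section Graded.
Variables (R : realType) (n : nat) (M : manifold R n) (w : bivector_family M)
  (e : frame_family M).
Variable c : chart M.
Local Notation V := 'rV[R]_n.
Local Notation form := (seq V -> R^o).
Local Notation U := (chart_image c).
Hypothesis w_poisson : poisson_bivector w.
Hypothesis e_frame : local_frame e.
Implicit Types (F G : form_family M) (z : int).

Let UO := @open_chart_image R n M c.

Section Sum.
Variables (I : Type) (r : seq I) (F : I -> form_family M).
Hypothesis regF : forall i, regular U (F i c).
Variable x : V.
Hypothesis Ux : U x.

Let form_is_diff_sumF : form_is_diff x ((\sum_(i <- r) F i) c)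
  (fun v => \sum_(i <- r) jet (F i c) x v).
Proof.
rewrite (_ : (\sum_(i <- r) F i) c = (fun y => \sum_(i <- r) (F i c y : form))).
  by apply: form_is_diff_sum => i; exact: (form_is_diff_jet (regF i)).
by apply/funext => y; exact: family_sumE.
Qed.

Lemma ext_d_sum : ext_d (\sum_(i <- r) F i) c x = \sum_(i <- r) (ext_d (F i) c x : form).
Proof.
rewrite (ext_dE Ux form_is_diff_sumF).
under [RHS]eq_bigr => i _ do rewrite (ext_dE Ux (form_is_diff_jet (regF i) Ux)).
by rewrite exchange_big; apply: eq_bigr => a _; exact: linear_sum.
Qed.

Lemma koszul_sum : koszul w e (\sum_(i <- r) F i) c x =
  \sum_(i <- r) (koszul w e (F i) c x : form).
Proof.
rewrite (koszulE w_poisson e_frame Ux _ form_is_diff_sumF); last first.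
- by move=> v; apply: is_form_sum => i _; exact: (is_form_jet UO).
- move=> y Uy; rewrite family_sumE; apply: (proj1 (_ : is_form _)); apply: is_form_sum => i _.
  exact: (regF i).1.
under [RHS]eq_bigr => i _ do rewrite (koszul_jet_form w_poisson e_frame (regF i) Ux).
rewrite /koszul_bv /koszul_jet sumrN exchange_big family_sumE /=; congr (- _).
apply: eq_bigr => a _; rewrite big_split /=; congr (_ + _).
  by rewrite (linear_sum (contr_row (@contr_bv R n) (w c x) a)).
by rewrite (linear_sum (contr_bivector (@contr_bv R n) _)) (linear_sum (wedge_dx R a)).
Qed.
End Sum.

Definition scale_family (r : R) F : form_family M := fun c x s => r * F c x s.

Lemma regular_scale r F : regular U (F c) -> regular U (scale_family r F c).
Proof.
move=> regF; split=> [x Ux|s x Ux].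
  exact: (is_formZ r (regF.1 x Ux)).
exact: (differentiableZ r (regF.2 s x Ux)).
Qed.

Lemma ext_d_scale r F x : regular U (F c) -> U x ->
  ext_d (scale_family r F) c x = r *: (ext_d F c x : form).
Proof.
move=> regF Ux.
rewrite (ext_dE Ux (form_is_diffZ r (form_is_diff_jet regF Ux)))
  (ext_dE Ux (form_is_diff_jet regF Ux)).
by rewrite scaler_sumr; apply: eq_bigr => a _; rewrite (linearZZ (wedge_dx R a)).
Qed.

Lemma koszul_scale r F x : regular U (F c) -> U x ->
  koszul w e (scale_family r F) c x = r *: (koszul w e F c x : form).
Proof.
move=> regF Ux; have regZ := regular_scale r regF.
have fd := form_is_diffZ r (form_is_diff_jet regF Ux).
rewrite (koszulE w_poisson e_frame Ux _ fd); last first.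
- by move=> v; apply: is_formZ; exact: (is_form_jet UO).
- by move=> y Uy; have [] := regZ.1 y Uy.
rewrite (koszul_jet_form w_poisson e_frame regF Ux) /koszul_bv /koszul_jet.
rewrite scalerN scaler_sumr; congr (- _); apply: eq_bigr => a _.
rewrite -[scale_family r F c x]/(r *: (F c x : form)).
by rewrite (linearZZ (contr_row (@contr_bv R n) (w c x) a))
  (linearZZ (contr_bivector (@contr_bv R n) _)) (linearZZ (wedge_dx R a)) scalerDr.
Qed.

Lemma koszul_out F x : ~ U x -> koszul w e F c x = 0.
Proof.
move=> Ux; rewrite -[LHS]/(contract_loc w e c (@ext_d_loc R n M c (F c)) x -
  @ext_d_loc R n M c (contract_loc w e c (F c)) x).
by rewrite contract_loc_out /ext_d_loc ?ext_d_out// subrr.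
Qed.

Section Leibniz.
Variables F G : form_family M.
Hypotheses (regF : regular U (F c)) (regG : regular U (G c)).

Lemma regular_qcoef z : regular U (qcoef w e z F G c).
Proof.
case: z => m /=; last first.
  by split=> [x _|s x _]; [exact: is_form0|exact: differentiable_cst].
exact: (@regular_scale _ (qterm w e m F G) (regular_qterm w_poisson e_frame regF regG m)).
Qed.

(** Division of [leibniz_order] by m! turns m / m! into 1 / (m-1)!, which is
the normalization of the previous coefficient. *)
Lemma leibniz_qcoef z (r : R) x : U x ->
  (forall s, (-1) ^+ size s * F c x s = r * F c x s) ->
  (ext_d (qcoef w e z F G) c x : form) - (koszul w e (qcoef w e (z - 1) F G) c x : form) =
  (qcoef w e z (ext_d F) G c x : form) - (qcoef w e (z - 1) (koszul w e F) G c x : form) +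
  r *: ((qcoef w e z F (ext_d G) c x : form) - (qcoef w e (z - 1) F (koszul w e G) c x : form)).
Proof.
move=> Ux Fr.
have d0 : (ext_d (0 : form_family M) c x : form) = 0.
  have := @ext_d_sum nat [::] (fun=> F) (fun=> regF) x Ux.
  by rewrite !big_nil.
have k0 : (koszul w e (0 : form_family M) c x : form) = 0.
  have := @koszul_sum nat [::] (fun=> F) (fun=> regF) x Ux.
  by rewrite !big_nil.
case: z => [m|m]; last first.
  (* For negative z all terms vanish. *)
  rewrite (_ : Negz m - 1 = Negz m.+1); last by rewrite !NegzE; lia.
  by rewrite /qcoef d0 k0 -![(0 : form_family M) c x]/(0 : form) subrr scaler0 addr0.
have Q p F' G' : (qcoef w e (Posz p) F' G' c x : form) =
  (p`!%:R)^-1 *: (qterm w e p F' G' c x : form) by [].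
have regQ p := regular_qterm w_poisson e_frame regF regG p.
have dQ p : (ext_d (qcoef w e (Posz p) F G) c x : form) =
  (p`!%:R)^-1 *: (ext_d (qterm w e p F G) c x : form).
  exact: ext_d_scale.
have kQ p : (koszul w e (qcoef w e (Posz p) F G) c x : form) =
  (p`!%:R)^-1 *: (koszul w e (qterm w e p F G) c x : form).
  exact: koszul_scale.
have L := leibniz_order w_poisson e_frame regF regG m Ux Fr.
case: m L => [|m] L.
  have -> : Posz 0 - 1 = Negz 0 by [].
  have Qn F' G' : (qcoef w e (Negz 0) F' G' c x : form) = 0 by [].
  have kQn : (koszul w e (qcoef w e (Negz 0) F G) c x : form) = 0 by exact: k0.
  rewrite dQ !Q !Qn kQn fact0 invr1 !scale1r !subr0.
  by move: L; rewrite !scale0r !subr0.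
have -> : Posz m.+1 - 1 = Posz m by rewrite intS addrC addKr.
rewrite dQ kQ !Q.
have fE : (m`!%:R : R)^-1 = (m.+1`!%:R)^-1 * m.+1%:R.
  by rewrite factS natrM invfM mulrAC mulVf ?mul1r// pnatr_eq0.
rewrite fE -!scalerA -!scalerBr L; exact: regroup_leibniz.
Qed.

Lemma qcoef_subl z (H H1 H2 : form_family M) x : U x ->
  (H c x : form) = (H1 c x : form) - (H2 c x : form) -> is_form (H1 c x) -> is_form (H2 c x) ->
  (qcoef w e z H G c x : form) = (qcoef w e z H1 G c x : form) - (qcoef w e z H2 G c x : form).
Proof.
move=> Ux HE f1 f2; have fG := regG.1 x Ux.
have fH : is_form (H c x) by rewrite HE; apply: is_formD => //; exact: is_formN.
case: z => m; last by rewrite /qcoef subr0.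
change ((m`!%:R)^-1 *: (qterm w e m H G c x : form) =
  (m`!%:R)^-1 *: (qterm w e m H1 G c x : form) - (m`!%:R)^-1 *: (qterm w e m H2 G c x : form)).
rewrite -scalerBr !(qtermE w e_frame _ Ux)//; congr (_ *: _).
rewrite HE.
exact: (linearB (@shuffle_lin R n \o @power R n _ (@contr_l R n) (@contr_r R n) (w c x) m \o
  tensorl (G c x))).
Qed.

Lemma qcoef_subr z (H H1 H2 : form_family M) x : U x ->
  (H c x : form) = (H1 c x : form) - (H2 c x : form) -> is_form (H1 c x) -> is_form (H2 c x) ->
  (qcoef w e z F H c x : form) = (qcoef w e z F H1 c x : form) - (qcoef w e z F H2 c x : form).
Proof.
move=> Ux HE f1 f2; have fF := regF.1 x Ux.
have fH : is_form (H c x) by rewrite HE; apply: is_formD => //; exact: is_formN.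
case: z => m; last by rewrite /qcoef subr0.
change ((m`!%:R)^-1 *: (qterm w e m F H c x : form) =
  (m`!%:R)^-1 *: (qterm w e m F H1 c x : form) - (m`!%:R)^-1 *: (qterm w e m F H2 c x : form)).
rewrite -scalerBr !(qtermE w e_frame _ Ux)//; congr (_ *: _).
rewrite HE.
exact: (linearB (@shuffle_lin R n \o @power R n _ (@contr_l R n) (@contr_r R n) (w c x) m \o
  tensorr (F c x))).
Qed.

End Leibniz.

Lemma Omega_smooth_form F : Omega F -> smooth_form c (F c).
Proof.
move=> [h1 h2 _ h4]; split; last exact: h4.
  by move=> x Ux; have [fl fa] := h1 c x Ux; exact: alternating_antisym.
exact: h2.
Qed.

Lemma Omega_regular F : Omega F -> regular U (F c).
Proof. by move=> /Omega_smooth_form; exact: smooth_form_regular. Qed.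

Lemma ext_d0 x : (ext_d (0 : form_family M) c x : form) = 0.
Proof.
have [Ux|Ux] := pselect (U x); last exact: ext_d_out.
have reg0 : regular U ((0 : form_family M) c).
  by split=> [y _|s y _]; [exact: is_form0|exact: differentiable_cst].
by have := @ext_d_sum nat [::] (fun=> 0) (fun=> reg0) x Ux; rewrite !big_nil.
Qed.

Lemma koszul0 x : (koszul w e (0 : form_family M) c x : form) = 0.
Proof.
have [Ux|Ux] := pselect (U x); last exact: koszul_out.
have reg0 : regular U ((0 : form_family M) c).
  by split=> [y _|s y _]; [exact: is_form0|exact: differentiable_cst].
by have := @koszul_sum nat [::] (fun=> 0) (fun=> reg0) x Ux; rewrite !big_nil.
Qed.

Lemma regular_sum (I : Type) (r : seq I) (F : I -> form_family M) :
  (forall i, regular U (F i c)) -> regular U ((\sum_(i <- r) F i) c).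
Proof.
move=> regF; split=> [x Ux|s x Ux].
  by rewrite family_sumE; apply: is_form_sum => i _; exact: (regF i).1.
rewrite (_ : (fun y => _) = (fun y => (\sum_(i <- r) (F i c y : form)) s)).
  have h := form_is_diff_sum r (fun i => form_is_diff_jet (regF i) Ux).
  by have [] := h s.
by apply/funext => y; rewrite family_sumE.
Qed.

Lemma d_h_sqr (alpha : hform M) m : (forall a, Omega (alpha a)) ->
  d_h w e (d_h w e alpha) m c = 0.
Proof.
move=> Oa; have S a := Omega_smooth_form (Oa a).
exact: (@deformed_differential_sqr R (V -> form) (@smooth_form R n M c) (@ext_d_loc R n M c)
  (contract_loc w e c)
  (@smooth_formB R n M c) (@smooth_form_ext_d_loc R n M c)
    (smooth_form_contract_loc w_poisson e_frame)
  (@ext_d_locB R n M c) (@contract_locB R n M w e c) (@ext_d_loc_sqr R n M c)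
  (contract_loc_commutator w_poisson e_frame) _ _ _ (S m) (S (m - 1)) (S (m - 1 - 1))).
Qed.

End Graded.

Section LaurentLeibniz.
Variables (R : realType) (n : nat) (M : manifold R n) (w : bivector_family M)
  (e : frame_family M).
Local Notation V := 'rV[R]_n.
Local Notation form := (seq V -> R^o).
Hypothesis w_poisson : poisson_bivector w.
Hypothesis e_frame : local_frame e.
Variables (alpha beta : hform M) (A B : {fset int}) (r : R).
Hypotheses (Oa : forall a, Omega (alpha a)) (Ob : forall b, Omega (beta b)).
Hypotheses (hA : forall a, a \notin A -> alpha a = 0) (hB : forall b, b \notin B -> beta b = 0).
Hypothesis sgn_alpha : forall a c x s, (-1) ^+ size s * alpha a c x s = r * alpha a c x s.

Lemma d_h_support (gamma : hform M) (C : {fset int}) :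
  (forall a, a \notin C -> gamma a = 0) ->
  forall a, a \notin succ_fset C -> d_h w e gamma a = 0.
Proof.
move=> hC a /notin_succ_fset[/hC a0 /hC a1]; apply/funext => c; apply/funext => x.
rewrite /d_h a0 a1.
have d0 := @ext_d0 R n M c x; have k0 := koszul0 c w_poisson e_frame x.
rewrite -[LHS]/((ext_d (0 : form_family M) c x : form) -
  (koszul w e (0 : form_family M) c x : form)).
by rewrite d0 k0 subrr.
Qed.

(** Both sides are sums of [leibniz_qcoef] over the supports of alpha and beta;
the codifferential terms of the right side carry one more power of h and are
reindexed accordingly. *)
Lemma laurent_leibniz m c x :
  (d_h w e (qwedge w e alpha beta) m c x : form) =
  (qwedge w e (d_h w e alpha) beta m c x : form) +
  r *: (qwedge w e alpha (d_h w e beta) m c x : form).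
Proof.
have hA' := d_h_support hA; have hB' := d_h_support hB.
rewrite (qwedgeE w e m hA' hB) (qwedgeE w e m hA hB').
rewrite -[LHS]/((ext_d (qwedge w e alpha beta m) c x : form) -
  (koszul w e (qwedge w e alpha beta (m - 1)) c x : form)).
rewrite !(qwedgeE w e _ hA hB).
have [Ux|Ux] := pselect (chart_image c x); last first.
  have d_out (F : hform M) a : d_h w e F a c x = 0.
    rewrite -[LHS]/((ext_d (F a) c x : form) - (koszul w e (F (a - 1)) c x : form)).
    by rewrite ext_d_out// koszul_out// subrr.
  rewrite ext_d_out// koszul_out// subrr !family_sumE big1 => [|a _]; last first.
    by rewrite family_sumE big1// => b _; apply: qcoef_eq0; left.
  rewrite big1 ?scaler0 ?addr0// => a _.
  by rewrite family_sumE big1// => b _; apply: qcoef_eq0; right.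
have ra a := Omega_regular c (Oa a); have rb b := Omega_regular c (Ob b).
have rQ z a b := regular_qcoef w_poisson e_frame (ra a) (rb b) z.
have rS z a : regular (chart_image c)
  ((\sum_(b <- B) qcoef w e (z - a - b) (alpha a) (beta b)) c).
  by apply: regular_sum => b; exact: rQ.
rewrite (ext_d_sum _ (rS m) Ux) (koszul_sum w_poisson e_frame _ (rS (m - 1)) Ux).
rewrite -sumrB !family_sumE.
have dax a := ext_d_form (ra a) Ux; have dbx b := ext_d_form (rb b) Ux.
have kax a := koszul_form w_poisson e_frame (ra a) Ux.
have kbx b := koszul_form w_poisson e_frame (rb b) Ux.
pose pa a := \sum_(b <- B) (qcoef w e (m - a - b) (ext_d (alpha a)) (beta b) c x : form).
pose qa a := \sum_(b <- B) (qcoef w e (m - a - b - 1) (koszul w e (alpha a)) (beta b) c x : form).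
pose pb a b := (qcoef w e (m - a - b) (alpha a) (ext_d (beta b)) c x : form).
pose qb a b := (qcoef w e (m - a - b - 1) (alpha a) (koszul w e (beta b)) c x : form).
have -> : \sum_(a <- succ_fset A) ((\sum_(b <- B) qcoef w e (m - a - b) (d_h w e alpha a)
  (beta b)) c x : form) =
    \sum_(a <- A) (pa a - qa a).
  rewrite sumrB -(@shift_fset_sum _ A qa); last first.
    move=> a /hA a0; rewrite /qa big1// => b _; apply: qcoef_eq0; left.
    by rewrite a0; exact: koszul0.
  rewrite -(@widen_fset_sum _ _ (succ_fset A) A pa); last 2 first.
  - move=> a /notin_succ_fset[/hA a0 _]; rewrite /pa big1// => b _; apply: qcoef_eq0; left.
    by rewrite a0; exact: ext_d0.
  - move=> a /hA a0; rewrite /pa big1// => b _; apply: qcoef_eq0; left.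
    by rewrite a0; exact: ext_d0.
  rewrite -sumrB; apply: eq_bigr => a _; rewrite family_sumE -sumrB; apply: eq_bigr => b _.
  rewrite (_ : m - (a - 1) - b - 1 = m - a - b); last by ring.
  by apply: (qcoef_subl w e_frame (rb b) _ Ux); [|exact: dax|exact: kax].
have -> : \sum_(a <- A) ((\sum_(b <- succ_fset B) qcoef w e (m - a - b) (alpha a)
  (d_h w e beta b)) c x : form) =
    \sum_(a <- A) \sum_(b <- B) (pb a b - qb a b).
  apply: eq_bigr => a _; rewrite family_sumE sumrB -(@shift_fset_sum _ B (qb a)); last first.
    move=> b /hB b0; apply: qcoef_eq0; right.
    by rewrite b0; exact: koszul0.
  rewrite -(@widen_fset_sum _ _ (succ_fset B) B (pb a)); last 2 first.
  - by move=> b /notin_succ_fset[/hB b0 _]; apply: qcoef_eq0; right; rewrite b0; exact: ext_d0.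
  - by move=> b /hB b0; apply: qcoef_eq0; right; rewrite b0; exact: ext_d0.
  rewrite -sumrB; apply: eq_bigr => b _; rewrite /qb.
  rewrite (_ : m - a - (b - 1) - 1 = m - a - b); last by ring.
  by apply: (qcoef_subr w e_frame (ra a) _ Ux); [|exact: dbx|exact: kbx].
rewrite scaler_sumr -big_split; apply: eq_bigr => a _.
rewrite (ext_d_sum _ (fun b => rQ _ a b) Ux)
  (koszul_sum w_poisson e_frame _ (fun b => rQ _ a b) Ux).
rewrite /pa /qa scaler_sumr -!sumrB -big_split; apply: eq_bigr => b _ /=.
rewrite (_ : m - 1 - a - b = m - a - b - 1); last by ring.
by apply: (leibniz_qcoef w_poisson e_frame (ra a) (rb b) _ Ux) => s; exact: sgn_alpha.
Qed.

End LaurentLeibniz.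

Lemma laurent_support (R : realType) (n : nat) (M : manifold R n) (alpha : hform M) :
  Omega_laurent alpha -> exists A : {fset int}, forall a, a \notin A -> alpha a = 0.
Proof.
move=> [_ /finite_fsetP[A AE]]; exists A => a; apply: contraNeq => a0.
by have /seteqP[/(_ a) h _] := AE; apply: h => /=; exact/eqP.
Qed.

Lemma homogeneous_sign (R : realType) (n : nat) (M : manifold R n) (alpha : hform M) (k : int) :
  homogeneous k alpha ->
  forall a c x s, (-1) ^+ size s * alpha a c x s = (-1) ^ k * alpha a c x s.
Proof.
move=> hk a c x s; have [->|/eqP h] := eqVneq (alpha a c x s) 0; first by rewrite !mulr0.
rewrite -(hk a c x s h) expfzDr ?oppr_eq0 ?oner_eq0// mulrC [a * 2]mulrC -exprz_exp.
by rewrite -[(-1) ^ 2]/((-1) ^+ 2) sqrrN expr1n exp1rz mulr1 mulrC.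
Qed.

Theorem theorem2p2 (R : realType) (n : nat) (M : manifold R n)
    (w : bivector_family M) (e : frame_family M)
    (w_poisson : poisson_bivector w) (e_frame : local_frame e) :
  (forall alpha : hform M,
     Omega_poly alpha \/ Omega_laurent alpha ->
     d_h w e (d_h w e alpha) = 0) /\
  (forall (alpha beta : hform M) (k : int),
     Omega_poly alpha /\ Omega_poly beta \/
     Omega_laurent alpha /\ Omega_laurent beta ->
     homogeneous k alpha ->
     d_h w e (qwedge w e alpha beta) =
     qwedge w e (d_h w e alpha) beta +
     signed k (qwedge w e alpha (d_h w e beta))).
Proof.
split=> [alpha h|alpha beta k h hk].
  have [Oa _] : Omega_laurent alpha by case: h => // -[].
  by apply/funext => m; apply/funext => c; exact: d_h_sqr.
have [La Lb] : Omega_laurent alpha /\ Omega_laurent beta by case: h => // -[[? _] [? _]].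
have [A hA] := laurent_support La; have [B hB] := laurent_support Lb.
apply/funext => m; apply/funext => c; apply/funext => x.
exact: (laurent_leibniz w_poisson e_frame La.1 Lb.1 hA hB (homogeneous_sign hk)).
Qed.
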